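(* Let $\mathfrak g$ be of type A$_n$ ($\mathfrak{sl}_{n+1}(\mathbb C)$) or type C$_n$ ($\mathfrak{sp}_{2n}(\mathbb C)$). For an FFLV-admissible set $A\subset R^-$ and a dominant integral weight $\lambda=\sum_{k=1}^nm_k\omega_k$, the set $\{\prod_\alpha f_\alpha^{s_\alpha}\cdot v_\lambda\mid\mathbf s\in S_A(\lambda)\}$ is in a weight preserving one-to-one correspondence with the set of $A$-permissible PBW-semistandard tableaux of shape $\lambda$ (of the type, A or C, of $\mathfrak g$).
   Context: Roots. Fix $\mathfrak g=\mathfrak n^+\oplus\mathfrak h\oplus\mathfrak n^-$, simple roots $\alpha_1,\dots,\alpha_n$ (standard numbering; $\alpha_n$ long in type C), fundamental weights $\omega_1,\dots,\omega_n$. Put $\alpha_{i,j}=\alpha_i+\dots+\alpha_j$ ($i\le j$). Type A$_n$: $R^+=\{\alpha_{i,j}\mid 1\le i\le j\le n\}$. Type C$_n$: $R^+=\{\alpha_{i,j},\alpha_{i,\overline j}\mid 1\le i\le j\le n\}$ with $\alpha_{i,\overline j}=\alpha_i+\dots+\alpha_{j-1}+2\alpha_j+\dots+2\alpha_{n-1}+\alpha_n$ and $\alpha_{i,\overline n}=\alpha_{i,n}$. $R^-=-R^+$; $f_\alpha$ is a fixed nonzero vector of $\mathfrak g_{-\alpha}$, $\alpha\in R^+$; $v_\lambda$ is a highest weight vector of the simple module $V(\lambda)$. The factors in monomials are in a fixed arbitrary order. Join. Write $\beta\le\gamma$ iff $\gamma-\beta\in\sum\mathbb Z_{\ge0}\alpha_i$.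 For $\delta\in R^-+R^-$ let $\mathcal P(\delta)=\{(\delta,0)\}$ if $-\delta$ is the highest root of a (connected) Dynkin subdiagram, and otherwise $\mathcal P(\delta)=\{(\beta_1,\beta_2)\in(R^-\cup\{0\})^2\mid\beta_1+\beta_2=\delta\}$. Write $(\beta_1,\beta_2)\le(\gamma_1,\gamma_2)$ iff $\gamma_1\le\beta_k\le\gamma_2$ for $k=1,2$; $<$ means $\le$ and $\ne$. For $\beta_1,\beta_2\in R^-$ the join is $\beta_1\oplus\beta_2=\{(\gamma_1,\gamma_2)\in\mathcal P(\beta_1+\beta_2)\mid(\beta_1,\beta_2)<(\gamma_1,\gamma_2)\}$; by abuse of notation it also denotes the set of (nonzero) roots occurring in these pairs. Order $\succ$. For $\alpha=-\sum a_i\alpha_i\in R^-$ ($a_i\ge0$) let $s=\min\{i\mid a_i\ne0\}$; for $\beta\in R^-$ put $\alpha\succ\beta$ if $\beta=\alpha+\alpha_s$ and $a_s=1$, or $\beta=\alpha-\alpha_j$ for some $j\ge s$; $\succ$ is the transitive closure, $\succeq$ its reflexive closure. The same notation is used on $R^+$ via $\alpha\leftrightarrow-\alpha$. Thus in type A $\alpha_{i,j}\succeq\alpha_{k,\ell}$ iff $i\le k$, $j\le\ell$; in type C, with $1<\dots<n<\overline{n-1}<\dots<\overline1$, $\alpha_{i,x}\succeq\alpha_{k,y}$ iff $i\le k$ and $x\le y$. Admissible. $A\subseteq R^-$ is FFLV-admissible if (1) $\bigoplus_{\alpha\in A}\mathfrak g_\alpha$ is a Lie subalgebra and (2) for all $\alpha,\beta\in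 A$ with $\alpha\succeq\beta$, all roots in $\alpha\oplus\beta$ lie in $A$. Polytopes. A Dyck path is a sequence $\mathbf p=(\beta_1,\dots,\beta_s)$ of positive roots with $\beta_i\succ\beta_{i+1}$, $\beta_1=\alpha_i$ a simple root (put $s(\mathbf p)=i$), and $\beta_s=\alpha_j$ a simple root (put $e(\mathbf p)=j$) or, additionally in type C, $\beta_s=\alpha_{j,\overline j}$ (put $e(\mathbf p)=n$). For $\lambda=\sum m_i\omega_i$, $$P(\lambda)=\Big\{(x_\alpha)\in\mathbb R_{\ge0}^{R^+}\ \Big|\ \sum_{\alpha\in\mathbf p}x_\alpha\le m_{s(\mathbf p)}+\dots+m_{e(\mathbf p)}\text{ for all Dyck paths }\mathbf p\Big\}.$$ $S_A(\lambda)$ is the set of lattice points of $P(\lambda)$ with $x_\alpha=0$ for all $\alpha\in R^+$ with $-\alpha\notin A$. Tableaux. Identify $\lambda=\sum m_k\omega_k$ with the partition $(\lambda_1\ge\dots\ge\lambda_n\ge0)$, $\lambda_k=m_k+\dots+m_n$; let $\mu_c$ be the length of the $c$-th column of its Young diagram $Y_\lambda$. A type A PBW-semistandard tableau of shape $\lambda$ is a filling of $Y_\lambda$ by numbers $T_{r,c}\in\{1,\dots,n+1\}$ ($r$ row, $c$ column) such that: (i) if $T_{r,c}\le\mu_c$ then $T_{r,c}=r$; (ii) if $r_1<r_2$ and $T_{r_1,c}\ne r_1$ then $T_{r_1,c}>T_{r_2,c}$; (iii) for any $c>1$ and any $r$ there is $r'\ge r$ with $T_{r',c-1}\ge T_{r,c}$.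 A type C PBW-semistandard tableau of shape $\lambda$ is a filling by $T_{r,c}\in\{1<\dots<n<\overline n<\dots<\overline1\}$ satisfying (i)–(iii) and: (iv) if $T_{r,c}=r$ and there is $r'$ with $T_{r',c}=\overline r$, then $r'<r$. Such a tableau is $A$-permissible if: (a) for every positive root $\alpha_{i,j}$ with $-\alpha_{i,j}\notin A$: $T_{i,c}\ne j+1$ for every column $c$ with $j\ge\mu_c$; and, additionally in type C, (b) for every positive root $\alpha_{i,\overline j}$ with $-\alpha_{i,\overline j}\notin A$: $T_{i,c}\ne\overline j$ for all columns $c$. (In type C, $\alpha_{i,n}=\alpha_{i,\overline n}$ corresponds to the entry $\overline n$, so (a) concerns $j<n$.) Weights. The weight of $\prod_\alpha f_\alpha^{s_\alpha}v_\lambda$ is $\lambda-\sum s_\alpha\alpha$; the weight of a tableau is the sum over its boxes of $\varepsilon_k$ for an entry $k$ and $-\varepsilon_k$ for an entry $\overline k$, with the usual $\omega_k=\varepsilon_1+\dots+\varepsilon_k$ (modulo $\varepsilon_1+\dots+\varepsilon_{n+1}$ in type A). *)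

(* Defs.v *)
From HB Require Import structures.
From Stdlib Require Import Relation_Operators.
From mathcomp Require Import all_boot all_order all_algebra.
From mathcomp Require Import boolp classical_sets functions reals.
From mathcomp Require Import complex.

Set Implicit Arguments.
Unset Strict Implicit.
Unset Printing Implicit Defensive.

Import Order.TTheory GRing.Theory Num.Theory.
Local Open Scope classical_set_scope.
Local Open Scope ring_scope.

(* Simple roots, fundamental weights, rows and columns are
   numbered from 1 as in the usual conventions; an ordinal [i] stands for the
   number [i.+1]. *)

Inductive cartan_type := TypeA | TypeC.

Definition is_C (tp : cartan_type) : bool :=
  if tp is TypeC then true else false.

(* Elements of the root lattice are vectors in 'rV[int]_n, in coordinates with
   respect to the simple roots. *)

Definition simple (n k : nat) : 'rV[int]_n := \row_(l < n) (l.+1 == k)%:Z.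

(* alpha_{i,j} *)
Definition aroot (n i j : nat) : 'rV[int]_n :=
  \sum_(i <= k < j.+1) simple n k.

(* alpha_{i, \bar j} *)
Definition croot (n i j : nat) : 'rV[int]_n :=
  \sum_(i <= k < j) simple n k + \sum_(j <= k < n) simple n k *+ 2
  + simple n n.

Definition pos_roots (tp : cartan_type) (n : nat) : seq 'rV[int]_n :=
  [seq aroot n i j | i <- iota 1 n, j <- iota i (n.+1 - i)] ++
  (if tp is TypeC then
     [seq croot n i j | i <- iota 1 n, j <- iota i (n.+1 - i)]
   else [::]).

(* R^+ as a finite type; the repetition alpha_{i,\bar n} = alpha_{i,n} in
   [pos_roots] is harmless. *)
Definition posroot (tp : cartan_type) (n : nat) : finType :=
  seq_sub (pos_roots tp n).

Definition neg_root (tp : cartan_type) (n : nat) : {pred 'rV[int]_n} :=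
  [pred b | - b \in pos_roots tp n].
Arguments neg_root tp n : clear implicits.

Definition root_le (n : nat) (b c : 'rV[int]_n) : bool :=
  [forall k : 'I_n, b 0 k <= c 0 k].

Definition dynkin_adj (n : nat) (a b : 'I_n) : bool :=
  (a.+1 == b) || (b.+1 == a).

Definition connected_subdiagram (n : nat) (I : {set 'I_n}) : bool :=
  (I != finset.set0) &&
  [forall a in I, forall b in I,
     connect (fun x y => [&& x \in I, y \in I & dynkin_adj x y]) a b].

Definition supported (n : nat) (I : {set 'I_n}) (b : 'rV[int]_n) : bool :=
  [forall k : 'I_n, (b 0 k != 0) ==> (k \in I)].

Definition highest_root_of (tp : cartan_type) (n : nat) (I : {set 'I_n})
    (t : 'rV[int]_n) : Prop :=
  [/\ t \in pos_roots tp n, supported I t &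
      forall b, b \in pos_roots tp n -> supported I b -> root_le b t].

(* P(delta) *)
Definition root_pairs (tp : cartan_type) (n : nat) (d : 'rV[int]_n) :
    set ('rV[int]_n * 'rV[int]_n) :=
  [set g | let high := exists I : {set 'I_n},
             connected_subdiagram I /\ highest_root_of tp I (- d) in
     (high /\ g = (d, 0)) \/
     (~ high /\ [/\ g.1 \in neg_root tp n \/ g.1 = 0,
                    g.2 \in neg_root tp n \/ g.2 = 0 & g.1 + g.2 = d])].

Definition pair_le (n : nat) (b g : 'rV[int]_n * 'rV[int]_n) : Prop :=
  (root_le g.1 b.1 /\ root_le b.1 g.2) /\
  (root_le g.1 b.2 /\ root_le b.2 g.2).

Definition pair_lt (n : nat) (b g : 'rV[int]_n * 'rV[int]_n) : Prop :=
  pair_le b g /\ b <> g.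

Definition join (tp : cartan_type) (n : nat) (b1 b2 : 'rV[int]_n) :
    set ('rV[int]_n * 'rV[int]_n) :=
  [set g | root_pairs tp (b1 + b2) g /\ pair_lt (b1, b2) g].

Definition join_roots (tp : cartan_type) (n : nat) (b1 b2 : 'rV[int]_n) :
    set 'rV[int]_n :=
  [set c | c <> 0 /\ exists2 g, join tp b1 b2 g & c = g.1 \/ c = g.2].

Definition first_index (n : nat) (a : 'rV[int]_n) (s : 'I_n) : Prop :=
  a 0 s <> 0 /\ forall k : 'I_n, (k < s)%N -> a 0 k = 0.

Definition succ_step (tp : cartan_type) (n : nat) (a b : 'rV[int]_n) : Prop :=
  [/\ a \in neg_root tp n, b \in neg_root tp n &
      exists2 s : 'I_n, first_index a s &
        (b = a + simple n s.+1 /\ a 0 s = -1) \/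
        (exists2 j : 'I_n, (s <= j)%N & b = a - simple n j.+1)].

Definition succ_root (tp : cartan_type) (n : nat) :
    'rV[int]_n -> 'rV[int]_n -> Prop :=
  clos_trans _ (@succ_step tp n).

Definition succeq_root (tp : cartan_type) (n : nat) (a b : 'rV[int]_n) : Prop :=
  a = b \/ succ_root tp a b.

(* sl_{n+1} and sp_{2n} are realised by matrices. For sp_{2n} the form is
   antidiagonal, so that the Cartan subalgebra is diagonal and the basis vector
   number 2n+1-k has weight -epsilon_k. *)

Definition natdim (tp : cartan_type) (n : nat) : nat :=
  if tp is TypeC then n.*2 else n.+1.

Definition symp_form (F : nzRingType) (n N : nat) : 'M[F]_N :=
  \matrix_(i, j) (if (i + j).+1 == n.*2 then (if (i < n)%N then 1 else -1)
                  else 0).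

Definition lie_alg (F : nzRingType) (tp : cartan_type) (n : nat) :
    set 'M[F]_(natdim tp n) :=
  [set x | if tp is TypeC then
             x^T *m symp_form F n _ + symp_form F n _ *m x = 0
           else \tr x = 0].

Definition bracket (F : nzRingType) (N : nat) (x y : 'M[F]_N) : 'M[F]_N :=
  x *m y - y *m x.

Definition cartan (F : nzRingType) (tp : cartan_type) (n : nat) :
    set 'M[F]_(natdim tp n) :=
  [set h | lie_alg h /\ is_diag_mx h].

(* Weights are linear functionals on the Cartan subalgebra, given by formulas
   for diagonal matrices; two of them agree when they agree on [cartan]. In
   type A the relation epsilon_1 + ... + epsilon_{n+1} = 0 is then the trace
   condition. *)

Definition eps (F : nzRingType) (N k : nat) (h : 'M[F]_N) : F :=
  \sum_(i < N | i.+1 == k) h i i.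

Definition simple_wt (F : nzRingType) (tp : cartan_type) (n k : nat)
    (h : 'M[F]_(natdim tp n)) : F :=
  if is_C tp && (k == n) then eps n h *+ 2 else eps k h - eps k.+1 h.

Definition root_wt (F : nzRingType) (tp : cartan_type) (n : nat)
    (a : 'rV[int]_n) (h : 'M[F]_(natdim tp n)) : F :=
  \sum_(k < n) (a 0 k)%:~R * simple_wt k.+1 h.

Definition fund_wt (F : nzRingType) (N k : nat) (h : 'M[F]_N) : F :=
  \sum_(1 <= i < k.+1) eps i h.

Definition hwt (F : nzRingType) (N n : nat) (m : 'I_n -> nat) (h : 'M[F]_N) :
    F :=
  \sum_(k < n) fund_wt k.+1 h *+ m k.

Definition root_space (F : nzRingType) (tp : cartan_type) (n : nat)
    (a : 'rV[int]_n) : set 'M[F]_(natdim tp n) :=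
  [set x | lie_alg x /\ forall h, cartan h -> bracket h x = root_wt a h *: x].

(* The direct sum of the root spaces g_a, a in A (A a set of negative roots). *)
Definition root_span (F : nzRingType) (tp : cartan_type) (n : nat)
    (A : {pred 'rV[int]_n}) : set 'M[F]_(natdim tp n) :=
  [set x | exists2 y : posroot tp n -> 'M[F]_(natdim tp n),
     (forall a, root_space (- val a) (y a) /\
                (- val a \notin A -> y a = 0)) &
     x = \sum_(a : posroot tp n) y a].

Definition lie_subalgebra (F : nzRingType) (tp : cartan_type) (n : nat)
    (L : set 'M[F]_(natdim tp n)) : Prop :=
  [/\ forall x, L x -> lie_alg x, L 0,
      forall (c : F) x y, L x -> L y -> L (c *: x + y) &
      forall x y, L x -> L y -> L (bracket x y)].

Definition FFLV_admissible (F : nzRingType) (tp : cartan_type) (n : nat)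
    (A : {pred 'rV[int]_n}) : Prop :=
  [/\ {subset A <= neg_root tp n},
      lie_subalgebra (@root_span F tp n A) &
      forall a b, a \in A -> b \in A -> succeq_root tp a b ->
        forall c, join_roots tp a b c -> c \in A].

(* A module is given by a map [rho] on all matrices, of which only the
   restriction to [lie_alg] matters. *)

Definition lie_module (F : fieldType) (tp : cartan_type) (n : nat)
    (V : vectType F) (rho : 'M[F]_(natdim tp n) -> 'End(V)) : Prop :=
  (forall (c : F) x y, lie_alg x -> lie_alg y ->
     rho (c *: x + y) = c *: rho x + rho y) /\
  (forall x y, lie_alg x -> lie_alg y -> forall u,
     rho (bracket x y) u = rho x (rho y u) - rho y (rho x u)).

Definition simple_module (F : fieldType) (tp : cartan_type) (n : nat)
    (V : vectType F) (rho : 'M[F]_(natdim tp n) -> 'End(V)) : Prop :=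
  [/\ lie_module rho, (fullv : {vspace V}) <> 0%VS &
      forall U : {vspace V},
        (forall x, lie_alg x -> (rho x @: U <= U)%VS) ->
        U = 0%VS \/ U = fullv].

Definition highest_weight_vector (F : fieldType) (tp : cartan_type) (n : nat)
    (m : 'I_n -> nat) (V : vectType F)
    (rho : 'M[F]_(natdim tp n) -> 'End(V)) (v : V) : Prop :=
  [/\ v <> 0,
      forall a x, a \in pos_roots tp n -> root_space a x -> rho x v = 0 &
      forall h, cartan h -> rho h v = hwt m h *: v].

(* prod_a f_a^{s_a} v, the factors being ordered according to [ord]. *)
Definition monomial_vector (F : fieldType) (tp : cartan_type) (n : nat)
    (V : vectType F) (rho : 'M[F]_(natdim tp n) -> 'End(V))
    (f : posroot tp n -> 'M[F]_(natdim tp n)) (ord : seq (posroot tp n))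
    (v : V) (s : {ffun posroot tp n -> nat}) : V :=
  foldr (fun a u => iter (s a) (rho (f a)) u) v ord.

Definition monomial_wt (F : nzRingType) (tp : cartan_type) (n : nat)
    (m : 'I_n -> nat) (s : {ffun posroot tp n -> nat})
    (h : 'M[F]_(natdim tp n)) : F :=
  hwt m h - \sum_(a : posroot tp n) root_wt (val a) h *+ s a.

Definition dyck_path (tp : cartan_type) (n : nat) (p : seq (posroot tp n))
    (st en : nat) : Prop :=
  exists b q,
  [/\ p = b :: q,
      sorted (fun x y => `[< succ_root tp (- val x) (- val y) >]) p,
      (1 <= st <= n)%N /\ val b = simple n st &
      ((1 <= en <= n)%N /\ val (last b q) = simple n en) \/
      [/\ is_C tp, en = n &
          exists2 j, (1 <= j <= n)%N & val (last b q) = croot n j j]].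

Definition FFLV_polytope (R : realType) (tp : cartan_type) (n : nat)
    (m : 'I_n -> nat) : set {ffun posroot tp n -> R} :=
  [set x : {ffun posroot tp n -> R} | (forall a, 0 <= x a) /\
     forall p st en, dyck_path p st en ->
       \sum_(a <- p) x a <= (\sum_(k < n | st <= k.+1 <= en) m k)%N%:R].

(* The points are nonnegative, so lattice points are stored with nat entries. *)
Definition S_A (R : realType) (tp : cartan_type) (n : nat)
    (A : {pred 'rV[int]_n}) (m : 'I_n -> nat) :
    set {ffun posroot tp n -> nat} :=
  [set s : {ffun posroot tp n -> nat} |
     @FFLV_polytope R tp n m [ffun a => (s a)%:R] /\
     forall a, - val a \notin A -> s a = 0%N].

(* The entries of a tableau are the numbers 1, ..., natdim; in type C the
   entry \bar k is the number 2n+1-k, so that the order of the alphabet is the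
   order of the numbers. *)

(* lambda_k *)
Definition part (n : nat) (m : 'I_n -> nat) (k : nat) : nat :=
  (\sum_(i < n | k <= i.+1) m i)%N.

(* The boxes (row, column) of the Young diagram. *)
Definition box (n : nat) (m : 'I_n -> nat) : finType :=
  {b : 'I_n * 'I_(part m 1) | (b.2.+1 <= part m b.1.+1)%N}.

Definition brow (n : nat) (m : 'I_n -> nat) (b : box m) : nat := (val b).1.+1.
Definition bcol (n : nat) (m : 'I_n -> nat) (b : box m) : nat := (val b).2.+1.

(* mu_c *)
Definition col_length (n : nat) (m : 'I_n -> nat) (c : nat) : nat :=
  #|[set b : box m | bcol b == c]%SET|.

Definition filling (tp : cartan_type) (n : nat) (m : 'I_n -> nat) : Type :=
  {ffun box m -> 'I_(natdim tp n)}.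

Definition entry (tp : cartan_type) (n : nat) (m : 'I_n -> nat)
    (T : filling tp m) (b : box m) : nat := (T b).+1.

Definition bar (n k : nat) : nat := (n.*2.+1 - k)%N.

Definition PBW_semistandard (tp : cartan_type) (n : nat) (m : 'I_n -> nat)
    (T : filling tp m) : Prop :=
  [/\ forall b, (entry T b <= col_length m (bcol b))%N -> entry T b = brow b,
      forall b1 b2, bcol b1 = bcol b2 -> (brow b1 < brow b2)%N ->
        entry T b1 <> brow b1 -> (entry T b2 < entry T b1)%N,
      forall b, (1 < bcol b)%N ->
        exists b', [/\ (bcol b').+1 = bcol b, (brow b <= brow b')%N &
                       (entry T b <= entry T b')%N] &
      is_C tp -> forall b b', bcol b = bcol b' ->
        entry T b = brow b -> entry T b' = bar n (brow b) ->
        (brow b' < brow b)%N].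

Definition permissible (tp : cartan_type) (n : nat) (A : {pred 'rV[int]_n})
    (m : 'I_n -> nat) (T : filling tp m) : Prop :=
  (forall i j, (1 <= i <= j)%N -> (if is_C tp then j < n else j <= n)%N ->
     - aroot n i j \notin A ->
     forall b : box m, brow b = i -> (col_length m (bcol b) <= j)%N ->
       entry T b <> j.+1) /\
  (is_C tp -> forall i j, (1 <= i <= j)%N -> (j <= n)%N ->
     - croot n i j \notin A ->
     forall b : box m, brow b = i -> entry T b <> bar n j).

Definition entry_wt (F : nzRingType) (tp : cartan_type) (n x : nat)
    (h : 'M[F]_(natdim tp n)) : F :=
  if is_C tp && (n < x)%N then - eps (bar n x) h else eps x h.

Definition tableau_wt (F : nzRingType) (tp : cartan_type) (n : nat)
    (m : 'I_n -> nat) (T : filling tp m) (h : 'M[F]_(natdim tp n)) : F :=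
  \sum_(b : box m) entry_wt (entry T b) h.

(* Main.v *)
(* Encode the roots [alpha_(i,j)] ([j < n] in type C) and [alpha_(i, bar j)] by
   pairs (row, entry) = [(i, j + 1)] and [(i, bar j)], so that the order on
   roots becomes the product order and a column of a PBW-semistandard tableau
   becomes an antichain. Sending a tableau to the multiplicities of its pairs
   identifies the tableaux of shape [lambda] with the lattice points of
   [P(lambda)]: conversely, the columns are recovered greedily, each being the
   set of maximal remaining pairs, and the Dyck path inequalities say exactly
   that nothing remains at the end. Permissibility only restricts the support
   of the multiplicities.

   It remains to see that distinct lattice points give distinct vectors. In the
   tensor power of the natural module indexed by the boxes, antisymmetrising
   along the columns gives a highest weight vector [w] of weight [lambda].
   A relation between monomials applied to [v] also holds for [w], since the
   tensor power carries a positive definite contravariant form. Finally, the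
   coefficient of the monomial [f^t w] at the tableau of [s] vanishes unless
   [sum_a t_a (length of a)^2 <= sum_a s_a (length of a)^2], with equality only
   if [t = s], where it does not vanish. *)

Require Import Defs.
From Stdlib Require Import Relation_Operators.
From mathcomp Require Import all_boot all_order all_algebra.
From mathcomp Require Import boolp classical_sets functions reals.
From mathcomp Require Import fingroup perm complex zify ring.

Set Implicit Arguments.
Unset Strict Implicit.
Unset Printing Implicit Defensive.

Import Order.TTheory GRing.Theory Num.Theory.
Local Open Scope classical_set_scope.
Local Open Scope ring_scope.

(** * Antichain decompositions *)

(** Why squares of lengths: a box that travels a distance [d] in several steps has lengths adding up
    to [d], so their squares add up to at most [d ^ 2], with equality only if there is at most one
    step. The column permutations inside [w] only shorten the available squared distance, by a
    rearrangement inequality for columns satisfying (i) and (ii). This count does not see the order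
    of the factors, so any fixed order is covered. In type C a root vector may have two nonzero
    entries, but a pair (old entry, new entry) still belongs to a single root, and the surviving
    contributions are all equal, so they cannot cancel. No homomorphism from the given module to the
    tensor power is built: a relation generated by both highest weight vectors is shown to be
    single-valued. In the combinatorial part the obstacle is that the bound on a chain may drop by
    one when a column is removed, although the chain avoids that column. Such a chain is then either
    prolonged by a maximal pair, which pays for the lost column, or seen through a smaller
    window. *)

Section Greedy.
Local Open Scope nat_scope.
Variables (P : finType) (ri ry : P -> nat).
Hypothesis pair_inj : forall x y, ri x = ri y -> ry x = ry y -> x = y.
Variables (mu : nat -> nat) (L : nat).
Hypothesis mu_anti : forall c d, c <= d -> mu d <= mu c.

Definition lep x y := (ri x <= ri y) && (ry x <= ry y).
Definition ltp x y := lep x y && (x != y).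

Lemma lep_trans y x z : lep x y -> lep y z -> lep x z.
Proof. by rewrite /lep => /andP[? ?] /andP[? ?]; apply/andP; split; lia. Qed.

Lemma lep_anti x y : lep x y -> lep y x -> x = y.
Proof. by rewrite /lep => /andP[? ?] /andP[? ?]; apply: pair_inj; lia. Qed.

Lemma ltp_trans : transitive ltp.
Proof.
move=> y x z /andP[xy nxy] /andP[yz nyz]; rewrite /ltp (lep_trans xy yz) /=.
by apply: contraNneq nxy => exz; rewrite (lep_anti xy) // exz.
Qed.

(* The columns of a PBW-semistandard tableau, each seen as the set of the roots
   that it encodes. *)
Definition family (col : nat -> pred P) :=
  [/\ forall c x, c < L -> col c x -> ri x <= mu c < ry x,
      forall c x y, c < L -> col c x -> col c y -> ~~ ltp x y &
      forall c x, c.+1 < L -> col c.+1 x -> mu c < ry x ->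
        exists2 y, col c y & lep x y].

(** Counts the columns from [c] on whose length lies in the window; for [c = 0] this will be the
    right-hand side of a Dyck path inequality. *)
Definition slots c i z := \sum_(c <= d < L) (i <= mu d < z).

Definition bounded c (r : P -> nat) :=
  forall p i z, sorted ltp p -> all (fun x => (i <= ri x) && (ry x <= z)) p ->
    \sum_(x <- p) r x <= slots c i z.

Lemma antichain_chain (D : pred P) p :
    (forall x y, D x -> D y -> ~~ ltp x y) -> sorted ltp p ->
  \sum_(x <- p) D x <= 1.
Proof.
move=> antiD; elim: p => [|x p IHp] sp; first by rewrite big_nil.
rewrite big_cons; have [Dx|nDx] := boolP (D x); last exact/IHp/(path_sorted sp).
rewrite big_seq big1 // => y yp.
have /allP/(_ y yp) xy := order_path_min ltp_trans sp.
by case: (boolP (D y)) => // Dy; have := antiD _ _ Dx Dy; rewrite xy.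
Qed.

(** The pairs of column [c] straddle the length [mu c]. Hence a chain inside the window meets this
    antichain at most once, and only if the window contains [mu c]. *)
Lemma family_bounded col : family col ->
  bounded 0 (fun x => \sum_(c < L) col c x).
Proof.
move=> [elig anti _] p i z sp /allP pP; rewrite exchange_big /= /slots.
rewrite big_mkord; apply: leq_sum => c _.
have [/hasP[x xp cx]|/hasPn hn] := boolP (has (col c) p); last first.
  by rewrite big_seq big1 // => x /hn; case: (col c x).
have /andP[h1 h2] := elig _ _ (ltn_ord c) cx; have /andP[h3 h4] := pP _ xp.
have -> : (i <= mu c < z) by lia.
exact: antichain_chain (fun _ _ => anti _ _ _ (ltn_ord c)) sp.
Qed.

Lemma maximal_exists (E : pred P) x : E x ->
  exists y, [/\ E y, lep x y & forall z, E z -> ~~ ltp y z].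
Proof.
move=> Ex; pose h y := ri y + ry y.
have Px : E x && lep x x by rewrite Ex /lep !leqnn.
case: (@arg_maxnP _ x (fun y => E y && lep x y) h Px) => y /andP[Ey xy] ymax.
exists y; split=> // z Ez; apply/negP => /andP[yz nyz].
have := ymax z; rewrite Ez (lep_trans xy yz) => /(_ isT); rewrite /h => hzy.
case/andP: (yz) => ? ?; move/eqP: nyz; apply; apply: pair_inj; lia.
Qed.

Definition maxcol c (r : P -> nat) : pred P := fun x =>
  [&& mu c < ry x, 0 < r x &
      [forall y, (mu c < ry y) && (0 < r y) ==> ~~ ltp x y]].

Lemma maxcol_exists c r x : mu c < ry x -> 0 < r x ->
  exists2 y, maxcol c r y & lep x y.
Proof.
move=> h1 h2.
have [|y [/andP[h3 h4] xy ymax]] :=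
  @maximal_exists (fun y => (mu c < ry y) && (0 < r y)) x; first by rewrite h1.
exists y => //; apply/and3P; split=> //.
by apply/forallP => z; apply/implyP => /ymax.
Qed.

Lemma maxcol_anti c r x y : maxcol c r x -> maxcol c r y -> ~~ ltp x y.
Proof.
by case/and3P => _ _ /forallP/(_ y)/implyP hx /and3P[h1 h2 _]; apply: hx;
  rewrite h1.
Qed.

Lemma maxcol_gt0 c r x : maxcol c r x -> 0 < r x.
Proof. by case/and3P. Qed.

Lemma slots_recl c i z : c < L ->
  slots c i z = (i <= mu c < z) + slots c.+1 i z.
Proof. by move=> cL; rewrite /slots big_ltn. Qed.

(** A one-element chain suffices: if [mu c < ri x], no remaining column is long enough to provide a
    slot for [x]. *)
Lemma bounded_elig c r x : bounded c r -> 0 < r x -> ri x <= mu c.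
Proof.
move=> br rx; have := br [:: x] (ri x) (ry x) isT.
rewrite /= !leqnn big_seq1 => /(_ isT) hle; rewrite leqNgt; apply/negP => hlt.
have : slots c (ri x) (ry x) = 0; last by lia.
rewrite /slots big_nat big1 // => d /andP[cd _].
by have := mu_anti cd; case: (leqP (ri x) (mu d)) => //; lia.
Qed.

Lemma sorted_rcons p x :
  sorted ltp (rcons p x) = all (ltp^~ x) p && sorted ltp p.
Proof. by rewrite !(sorted_pairwise ltp_trans) pairwise_rcons. Qed.

(** Only windows containing [mu c] lose a slot. The chain must then lose one unit as well, or
    satisfy a sharper bound; its last element decides which of the two happens. *)
Lemma bounded_step c r : c < L -> bounded c r ->
  bounded c.+1 (fun x => r x - maxcol c r x).
Proof.
move=> cL br p0 i z sp0 allp0; pose r' x := r x - maxcol c r x.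
(* Elements with no multiplicity left are dropped, so that the last element of the chain has
   positive multiplicity and, if eligible, lies below a maximal one. *)
rewrite -/(r' _); set p := [seq x <- p0 | 0 < r' x].
have -> : \sum_(x <- p0) r' x = \sum_(x <- p) r' x.
  rewrite big_filter [RHS]big_mkcond /=; apply: eq_bigr => x _.
  by case: (r' x).
have {sp0} sp : sorted ltp p by apply: sorted_filter sp0 => //;
  apply: ltp_trans.
have allp : all (fun x => (i <= ri x) && (ry x <= z)) p.
  by apply/allP => x; rewrite mem_filter => /andP[_ /(allP allp0)].
have posp : all (fun x => 0 < r' x) p by apply: filter_all.
move: p sp allp posp => p sp allp posp {p0 allp0}.
have r'r x : r' x <= r x by rewrite leq_subr.
have hr' q : \sum_(x <- q) r' x <= \sum_(x <- q) r x by apply: leq_sum.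
have := br _ _ _ sp allp; rewrite slots_recl // => hr.
have [/andP[h1 h2]|h] := boolP (i <= mu c < z); last first.
  by rewrite (negPf h) in hr; exact: leq_trans (hr' p) hr.
rewrite h1 h2 add1n /= in hr.
case/lastP: p sp allp posp hr => [|q x] sp allp posp hr;
  first by rewrite big_nil.
move: (sp) (allp) (posp); rewrite sorted_rcons !all_rcons.
case/andP=> ltq sq /andP[/andP[ix xz] allq] /andP[x0 posq].
(* If the last element is not eligible, the window can be shrunk to end at [ry x]; it then misses
   [mu c], so column [c] provides no slot to begin with. *)
have [yx|xy] := leqP (ry x) (mu c).
  have allp' : all (fun x' => (i <= ri x') && (ry x' <= ry x)) (rcons q x).
    apply/allP => u; rewrite mem_rcons inE => /orP[/eqP->|uq];
      first by rewrite ix leqnn.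
    have /andP[-> _] := allP allq _ uq.
    by case/andP: (allP ltq _ uq) => /andP[].
  have := br _ _ _ sp allp'; rewrite slots_recl // h1 ltnNge yx /= add0n => hb.
  apply: leq_trans (hr' _) (leq_trans hb _); rewrite /slots;
    apply: leq_sum => d _.
  case: (i <= mu d) => //=; case: (ltnP (mu d) (ry x)) => //= h.
  by rewrite (leq_trans h xz).
have rx : 0 < r x by apply: leq_trans x0 (r'r x).
have [y my xley] := maxcol_exists xy rx.
have [eyx|nyx] := eqVneq x y.
  rewrite -ltnS; apply: leq_trans hr.
  rewrite -!cats1 !big_cat /= !big_seq1 -addnS leq_add ?hr' //.
  by rewrite /r' eyx my subn1 prednK // (maxcol_gt0 my).
have sp' : sorted ltp (rcons (rcons q x) y).
  rewrite sorted_rcons sp andbT all_rcons /ltp xley nyx /=.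
  apply/allP => u /(allP ltq)/andP[ux nux]; rewrite /ltp (lep_trans ux xley) /=.
  by apply: contraNneq nux => e; rewrite (lep_anti ux) // e.
case/andP: (xley) => riy ryy.
(* The window is enlarged to contain the maximal element [y]. This adds no later column, since all
   later lengths are at most [mu c < z]. *)
have := br _ i (maxn z (ry y)) sp';
  rewrite !all_rcons !leq_max leqnn orbT ix xz /=.
rewrite (leq_trans ix riy) /= slots_recl // h1 leq_max h2 /= => hb.
rewrite -ltnS; apply: leq_trans (leq_trans (hb _) _).
- rewrite -(cats1 _ y) big_cat big_seq1 /= -addn1 leq_add ?hr' //.
  exact: maxcol_gt0 my.
- by apply/allP => u /(allP allq)/andP[-> uz]; rewrite leq_max uz.
rewrite add1n ltnS /slots big_nat [leqRHS]big_nat;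
  apply: leq_sum => d /andP[cd _].
have h := leq_ltn_trans (mu_anti (ltnW cd)) h2.
by rewrite h leq_max h.
Qed.

Section Decompose.
Variable s : P -> nat.
Hypothesis bs : bounded 0 s.

Fixpoint remainder c : P -> nat :=
  if c is d.+1 then fun x => remainder d x - maxcol d (remainder d) x else s.

Definition greedy c : pred P := maxcol c (remainder c).

Lemma remainder_bounded c : c <= L -> bounded c (remainder c).
Proof. by elim: c => //= c IHc cL; apply: bounded_step => //;
  apply/IHc/ltnW. Qed.

Lemma remainderE c x : remainder c x = remainder c.+1 x + greedy c x.
Proof.
rewrite /= -/(greedy c) subnK // /greedy.
by case: (boolP (maxcol _ _ x)) => // /maxcol_gt0.
Qed.

Lemma greedy_family : family greedy.
Proof.
split=> [c x cL gx|c x y _|c x cL gx hx].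
- have /and3P[-> h _] := gx.
  by rewrite (bounded_elig (remainder_bounded (ltnW cL)) h).
- exact: maxcol_anti.
- apply: maxcol_exists => //.
  by rewrite remainderE ltn_addr // (maxcol_gt0 gx).
Qed.

(** After [L] columns no slot is left, and the bound for one-element chains forces the remainder to
    vanish. *)
Lemma sum_greedy x : \sum_(c < L) greedy c x = s x.
Proof.
have h c : s x = \sum_(d < c) greedy d x + remainder c x.
  elim: c => [|c IHc]; first by rewrite big_ord0.
  by rewrite big_ord_recr IHc remainderE addnA addnAC.
rewrite (h L); suff -> : remainder L x = 0 by rewrite addn0.
have := @remainder_bounded L (leqnn L) [:: x] (ri x) (ry x) isT.
by rewrite /= !leqnn big_seq1 /slots big_geq // leqn0 => /(_ isT)/eqP.
Qed.

End Decompose.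

(** Domination between neighbouring columns can be iterated down to [c]: as [mu] is nonincreasing,
    [mu c < ry x] supplies the condition required at every intermediate column. *)
Lemma family_dom col c d x : family col -> c <= d -> d < L -> col d x ->
  mu c < ry x -> exists2 y, col c y & lep x y.
Proof.
move=> [_ _ dom]; elim: d x => [|d IHd] x.
  by rewrite leqn0 => /eqP-> _ cx _; exists x; rewrite // /lep !leqnn.
rewrite leq_eqVlt ltnS => /orP[/eqP-> _ cx _|cd dL cx hx].
  by exists x; rewrite // /lep !leqnn.
have [|y cy xy] := dom _ _ dL cx; first by have := mu_anti cd; lia.
have /andP[_ hy] := xy.
have [|z cz yz] := IHd y cd (ltnW dL) cy; first by lia.
by exists z => //; apply: lep_trans yz.
Qed.

(** Every element of a later column that is eligible for [c] lies below an element of the antichain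
    [col c]. So the total multiplicities from [c] on determine column [c], whence uniqueness. *)
Lemma family_maxcol col c : family col -> c < L ->
  col c =1 maxcol c (fun x => \sum_(c <= d < L) col d x).
Proof.
move=> fam cL x; have [elig anti _] := fam.
have maxP y : mu c < ry y -> 0 < \sum_(c <= d < L) col d y ->
    exists2 z, col c z & lep y z.
  move=> hy; rewrite lt0n sum_nat_seq_neq0 => /hasP[d].
  rewrite mem_index_iota => /andP[cd dL]; case: (boolP (col d y)) => // cy _.
  exact: family_dom fam cd dL cy hy.
apply/idP/idP => [cx|/and3P[h1 h2 /forallP h3]].
  have /andP[h1 h2] := elig _ _ cL cx; rewrite /maxcol h2 big_ltn // cx /=.
  apply/forallP => y; apply/implyP => /andP[hy yr]; apply/negP => xy.
  have [z cz yz] := maxP _ hy yr.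
  have /negP := anti _ _ _ cL cx cz; apply.
  case/andP: xy => xy nxy; rewrite /ltp (lep_trans xy yz) /=.
  by apply: contraNneq nxy => exz; rewrite (lep_anti xy) // exz.
have [z cz xz] := maxP _ h1 h2.
have [->//|nxz] := eqVneq x z.
have /andP[_ hz] := elig _ _ cL cz.
have := h3 z; rewrite hz big_ltn // cz /= => /negP[].
by rewrite /ltp xz nxz.
Qed.

Lemma family_inj col col' : family col -> family col' ->
    (forall x, \sum_(c < L) col c x = \sum_(c < L) col' c x) ->
  forall c, c < L -> col c =1 col' c.
Proof.
move=> fam fam' e.
have eqmax c : (forall x, \sum_(c <= d < L) col d x = \sum_(c <= d < L) col' d
  x) ->
    forall x, maxcol c (fun x => \sum_(c <= d < L) col d x) x =
              maxcol c (fun x => \sum_(c <= d < L) col' d x) x.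
  by move=> h x; rewrite /maxcol h; under eq_forallb do rewrite h.
have h c : c <= L ->
    forall x, \sum_(c <= d < L) col d x = \sum_(c <= d < L) col' d x.
  elim: c => [_ x|c IHc cL x]; first by rewrite !big_mkord e.
  have := IHc (ltnW cL) x; rewrite !(big_ltn cL).
  rewrite (family_maxcol fam cL) (family_maxcol fam' cL) eqmax;
    first exact: addnI.
  exact/IHc/ltnW.
move=> c cL x; rewrite (family_maxcol fam cL) (family_maxcol fam' cL) eqmax //.
exact/h/ltnW.
Qed.

End Greedy.

(** * Roots as pairs *)

Section Roots.
Variables (tp : cartan_type) (n : nat).

(** In type C, [epsilon_k - epsilon_(k+1)] with [k > n] is the simple root of index [2n - k],
    because [epsilon_(2n+1-k) = - epsilon_k]. Folding lets one telescoping sum serve both types. *)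
Definition fold_index k := if is_C tp && (n < k)%N then (n.*2 - k)%N else k.

(* The root [epsilon_a - epsilon_b], where [epsilon_(2n+1-k) = - epsilon_k] in
   type C. *)
Definition eps_root (a b : nat) : 'rV[int]_n :=
  \sum_(a <= k < b) simple n (fold_index k).

Definition top_entry a := if is_C tp then bar n a else n.+1.

(* In type C each positive root is [eps_root a b] for two pairs [(a, b)] in
   general; this condition selects one of them. *)
Definition canonical_pair a b := [&& 0 < a, a < b & b <= top_entry a]%N.

Lemma eps_rootE a b (l : 'I_n) :
  eps_root a b 0 l = (\sum_(a <= k < b) (fold_index k == l.+1))%N%:Z.
Proof.
rewrite /eps_root summxE (big_morph Posz PoszD (erefl _)).
by apply: eq_bigr => k _; rewrite mxE eq_sym.
Qed.

Lemma canonical_pair_le a b : canonical_pair a b ->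
  [&& 0 < a, a <= n, a < b & b <= natdim tp n]%N.
Proof. rewrite /canonical_pair /top_entry /bar.
by case: tp => /= /and3P[? ? ?]; apply/and4P; split; lia.
Qed.

Lemma fold_index_canonical a b k : canonical_pair a b -> (a <= k < b)%N ->
  (a <= fold_index k <= n)%N.
Proof.
rewrite /canonical_pair /top_entry /bar /fold_index.
case: tp => /= /and3P[? ? ?] /andP[? ?]; first by apply/andP; split; lia.
by case: ltnP => ?; apply/andP; split; lia.
Qed.

Lemma fold_index_ltn a b : (0 < a)%N -> (b <= natdim tp n)%N ->
  forall k, (a <= k < b)%N -> (0 < fold_index k <= n)%N.
Proof.
rewrite /fold_index; case: tp => /= ? ? k /andP[? ?]; first by apply/andP;
  split; lia.
by case: (ltnP n k) => ?; apply/andP; split; lia.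
Qed.

Lemma eps_root_height a b : (0 < a)%N -> (b <= natdim tp n)%N ->
  \sum_l eps_root a b 0 l = (b - a)%N%:Z.
Proof.
move=> a0 bN; under eq_bigr do rewrite eps_rootE.
rewrite -(big_morph Posz PoszD (erefl _)) exchange_big /=; congr Posz.
rewrite big_nat -[RHS]muln1 -sum_nat_const_nat [RHS]big_nat.
apply: eq_bigr => k /(fold_index_ltn a0 bN)/andP[h1 h2].
have h : ((fold_index k).-1 < n)%N by lia.
rewrite (bigD1 (Ordinal h)) //= prednK // eqxx big1 // => l.
by rewrite -val_eqE /= => hl; case: eqP => //; lia.
Qed.

Lemma eps_root_first a b (l : 'I_n) : canonical_pair a b ->
  (l.+1 < a)%N -> eps_root a b 0 l = 0.
Proof.
move=> hab la; rewrite eps_rootE big_nat big1 // => k /(fold_index_canonical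
  hab).
by case: eqP => //; lia.
Qed.

Lemma eps_root_first_neq0 a b (l : 'I_n) : canonical_pair a b ->
  l.+1 = a -> eps_root a b 0 l != 0.
Proof.
move=> /canonical_pair_le/and4P[h1 h2 h3 h4] la; rewrite eps_rootE big_ltn //.
by rewrite /fold_index ltnNge h2 andbF la eqxx add1n.
Qed.

(** The first nonzero coordinate gives [a], and the height [b - a] then gives [b]. *)
Lemma eps_root_inj a b a' b' : canonical_pair a b -> canonical_pair a' b' ->
  eps_root a b = eps_root a' b' -> a = a' /\ b = b'.
Proof.
move=> h h' e.
have aux c d c' d' : canonical_pair c d -> canonical_pair c' d' ->
    eps_root c d = eps_root c' d' -> (c <= c')%N.
  move=> hc hc' ec; rewrite leqNgt; apply/negP => lt.
  have /and4P[h1 h2 _ _] := canonical_pair_le hc'.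
  have lt' : (c'.-1 < n)%N by lia.
  have := eps_root_first_neq0 (l := Ordinal lt') hc'.
  rewrite /= prednK // -ec => /(_ (erefl _)).
  by rewrite eps_root_first ?eqxx //= prednK.
have ea : a = a' by apply/eqP;
  rewrite eqn_leq (aux a b a' b') // (aux a' b' a b).
split=> //; subst a'.
have /and4P[h1 h2 h3 h4] := canonical_pair_le h.
have /and4P[h1' h2' h3' h4'] := canonical_pair_le h'.
have := eps_root_height h1 h4; rewrite e eps_root_height // => -[]; lia.
Qed.

(** The reflection of [k] to [2n - k] exchanges the two ranges of summation and leaves [fold_index]
    unchanged. *)
Lemma eps_root_flip a b : is_C tp -> (0 < a)%N -> (a < b <= n.*2)%N ->
  eps_root (bar n b) (bar n a) = eps_root a b.
Proof.
move=> hC a0 /andP[ab bN]; rewrite /eps_root /bar.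
rewrite -{1}[(_ - b)%N]add0n -{2}[a]add0n !big_addn big_nat_rev /=.
have -> : (n.*2.+1 - a - (n.*2.+1 - b) = b - a)%N by lia.
rewrite big_nat [RHS]big_nat; apply: eq_bigr => k hk.
rewrite /fold_index hC /=; congr (simple n _).
case: (ltnP n (k + a)) => h1; case: ltnP => h2; lia.
Qed.

Lemma eps_root_low a b : (b <= n.+1)%N ->
  eps_root a b = \sum_(a <= k < b) simple n k.
Proof.
move=> bn; rewrite /eps_root big_nat [RHS]big_nat; apply: eq_bigr => k hk.
rewrite /fold_index; suff -> : (n < k)%N = false by rewrite andbF.
by lia.
Qed.

Lemma aroot_eps i j : (j <= n)%N -> aroot n i j = eps_root i j.+1.
Proof. by move=> jn; rewrite eps_root_low. Qed.

Lemma croot_eps i j : is_C tp -> (i <= j)%N -> (0 < j <= n)%N ->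
  croot n i j = eps_root i (bar n j).
Proof.
move=> hC ij /andP[j0 jn]; rewrite /croot.
have -> : eps_root i (bar n j) =
    eps_root i j + eps_root j n + eps_root n n.+1 + eps_root n.+1 (bar n j).
  rewrite /eps_root /bar -!big_cat_nat //=; lia.
(* The part beyond [n] folds back onto the indices from [j] to [n - 1]; this is the origin of the
   coefficients 2. *)
have -> : eps_root n.+1 (bar n j) = eps_root j n.
  have := @eps_root_flip j n hC j0; rewrite /bar.
  case: (ltngtP j n) => [jn'|jn'|->] h; [|lia|].
    by rewrite -h; [congr eps_root; lia | lia].
  by rewrite /eps_root !big_geq //; lia.
rewrite !eps_root_low; try lia.
by rewrite big_nat1 sumrMnl mulr2n -!addrA [simple n n + _]addrC.
Qed.

Lemma pos_rootsP (r : 'rV[int]_n) :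
  reflect (exists a b, canonical_pair a b /\ r = eps_root a b)
          (r \in pos_roots tp n).
Proof.
rewrite mem_cat; apply: (iffP orP) => [[]|].
- case/allpairsPdep => i [j []]; rewrite !mem_iota => hi hj ->.
  exists i, j.+1; rewrite aroot_eps; last by lia.
  split=> //; rewrite /canonical_pair /top_entry /bar.
  by move: hi hj => /andP[? ?] /andP[? ?]; case: tp => /=; apply/and3P; split;
    lia.
- move: (@croot_eps); rewrite /canonical_pair /top_entry.
  case: tp => // he /allpairsPdep[i [j []]]; rewrite !mem_iota => hi hj ->.
  exists i, (bar n j); rewrite he //; try lia.
  by move: hi hj; rewrite /bar /= => /andP[? ?] /andP[? ?]; split=> //;
    apply/and3P; split; lia.
case=> a [b [hab ->]]; have /and4P[h1 h2 h3 h4] := canonical_pair_le hab.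
have [bn|bn] := leqP b n.+1.
  left; apply/allpairsPdep; exists a, b.-1; rewrite !mem_iota aroot_eps;
    last by lia.
  by split; [lia|lia|congr eps_root; lia].
right; move: hab h4 bn (@croot_eps); rewrite /canonical_pair /top_entry.
case: tp => /= [|hab h4 bn he]; first by lia.
apply/allpairsPdep; exists a, (bar n b); rewrite !mem_iota.
move: hab; rewrite /bar => /and3P[? ? ?].
split; [lia|lia|rewrite he //; try lia].
by rewrite /bar; congr eps_root; lia.
Qed.

Lemma canonical_pair_flip a b : (0 < a)%N -> (a < b <= natdim tp n)%N ->
  canonical_pair a b \/ is_C tp /\ canonical_pair (bar n b) (bar n a).
Proof.
rewrite /canonical_pair /top_entry /bar; case: tp => /= a0 /andP[ab bN].
  by left; rewrite a0 ab.
have [h|h] := leqP b (n.*2.+1 - a); first by left; rewrite a0 ab.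
by right; split=> //; apply/and3P; split; lia.
Qed.

Lemma eps_root_pos a b : (0 < a)%N -> (a < b <= natdim tp n)%N ->
  eps_root a b \in pos_roots tp n.
Proof.
move=> a0 hab; apply/pos_rootsP.
have [|[hC]] := canonical_pair_flip a0 hab; first by exists a, b.
exists (bar n b), (bar n a); split=> //; rewrite eps_root_flip //.
by move: hab hC; case: tp.
Qed.

Lemma posroot_pair (x : posroot tp n) :
  exists p : nat * nat, canonical_pair p.1 p.2 && (val x == eps_root p.1 p.2).
Proof.
by have /pos_rootsP[a [b [h ->]]] := valP x; exists (a, b); rewrite h eqxx.
Qed.

Definition root_row (x : posroot tp n) : nat := (xchoose (posroot_pair x)).1.
Definition root_entry (x : posroot tp n) : nat := (xchoose (posroot_pair x)).2.

Lemma root_canonical x : canonical_pair (root_row x) (root_entry x).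
Proof. by have /andP[] := xchooseP (posroot_pair x). Qed.

Lemma rootE x : val x = eps_root (root_row x) (root_entry x).
Proof. by have /andP[_ /eqP] := xchooseP (posroot_pair x). Qed.

Lemma root_pair_inj x y :
  root_row x = root_row y -> root_entry x = root_entry y -> x = y.
Proof. by move=> e1 e2; apply: val_inj; rewrite !rootE e1 e2. Qed.

Lemma root_of_pair a b : canonical_pair a b ->
  exists x : posroot tp n, root_row x = a /\ root_entry x = b.
Proof.
move=> h; have hr : eps_root a b \in pos_roots tp n by apply/pos_rootsP;
  exists a, b.
exists (SeqSub hr).
by have [] := eps_root_inj (root_canonical (SeqSub hr)) h (esym (rootE _)).
Qed.

Lemma root_pairE x a b : canonical_pair a b -> val x = eps_root a b ->
  root_row x = a /\ root_entry x = b.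
Proof.
move=> h e; apply: eps_root_inj => //; first exact: root_canonical.
by rewrite -rootE.
Qed.

End Roots.

(** * Dyck paths and chains *)

Section DyckPaths.
Variables (tp : cartan_type) (n : nat).
Notation root := (posroot tp n).
Notation row := (@root_row tp n).
Notation ent := (@root_entry tp n).
Notation ltr := (ltp row ent).

Lemma top_entry_anti a b : (a <= b)%N ->
  (top_entry tp n b <= top_entry tp n a)%N.
Proof. by rewrite /top_entry /bar; case: tp => //= ?; lia. Qed.

Lemma canonical_pair_ltn a b : canonical_pair tp n a b -> (a.+1 < b)%N ->
  (a < n)%N.
Proof.
by rewrite /canonical_pair /top_entry /bar; case: tp => /= /and3P[? ? ?] ?; lia.
Qed.

Lemma simple_eps a : (a <= n)%N -> simple n a = eps_root tp n a a.+1.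
Proof. by move=> an; rewrite eps_root_low // big_nat1. Qed.

Lemma root_height (x : root) : \sum_l val x 0 l = (ent x - row x)%N%:Z.
Proof.
have /and4P[h1 h2 h3 h4] := canonical_pair_le (root_canonical x).
by rewrite rootE eps_root_height.
Qed.

Lemma simple_height j : (0 < j <= n)%N -> \sum_l simple n j 0 l = 1.
Proof.
case/andP=> j0 jn; rewrite simple_eps // (@eps_root_height tp) ?subSnn //.
by case: tp => /=; lia.
Qed.

Lemma root_rowE (x : root) (l : 'I_n) :
  (forall k : 'I_n, (k < l)%N -> val x 0 k = 0) -> val x 0 l != 0 ->
  row x = l.+1.
Proof.
move=> hlt hl; have hc := root_canonical x.
have /and4P[h1 h2 h3 h4] := canonical_pair_le hc.
have hr : ((row x).-1 < n)%N by lia.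
case: (ltngtP (row x) l.+1) => // h.
  have hn : val x 0 (Ordinal hr) != 0.
    by rewrite rootE (eps_root_first_neq0 hc) //= prednK.
  by move: hn; rewrite hlt ?eqxx //=; lia.
by move: hl; rewrite rootE (eps_root_first hc) ?eqxx.
Qed.

Lemma first_index_row (x : root) (s : 'I_n) :
  first_index (- val x) s -> row x = s.+1.
Proof.
case=> hs hlt; apply: root_rowE => [k /hlt/eqP|].
  by rewrite mxE oppr_eq0 => /eqP.
by apply/eqP => e; apply: hs; rewrite mxE e oppr0.
Qed.

Lemma row_first_index (x : root) (s : 'I_n) :
  row x = s.+1 -> first_index (- val x) s.
Proof.
move=> e; have hc := root_canonical x; split=> [/eqP|k ks]; rewrite mxE.
  by rewrite oppr_eq0 rootE; apply/negP/(eps_root_first_neq0 hc).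
by rewrite rootE (eps_root_first hc) ?oppr0 // e.
Qed.

Lemma root_ge0 (x : root) l : 0 <= val x 0 l.
Proof. by rewrite rootE eps_rootE. Qed.

(** Removing a leading simple root of coefficient 1 makes the support start one index later, and
    adding a simple root of index at least [s] does not move its start. In both cases the height
    then gives the entry. *)
Lemma succ_step_pair (x y : root) : succ_step tp (- val x) (- val y) ->
  (row y = (row x).+1 /\ ent y = ent x) \/ (row y = row x /\ ent y = (ent
    x).+1).
Proof.
case=> _ _ [s /first_index_row rx].
have hcx := root_canonical x.
have /and4P[x1 x2 x3 x4] := canonical_pair_le hcx.
have /and4P[y1 y2 y3 y4] := canonical_pair_le (root_canonical y).
have xlow (k : 'I_n) : (k < s)%N -> val x 0 k = 0.
  by move=> ks; rewrite rootE (eps_root_first hcx) // rx.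
have xs : val x 0 s != 0 by rewrite rootE (eps_root_first_neq0 hcx).
case=> [[e e1]|[j sj e]].
- left; have {}e : val x = val y + simple n s.+1.
    by apply: oppr_inj; rewrite opprD e addrK.
  have hh : (ent x - row x = (ent y - row y).+1)%N.
    have := root_height x; rewrite e.
    under eq_bigr do rewrite mxE; rewrite big_split /= root_height.
    by rewrite simple_height ?ltn_ord //; lia.
  have hs1 : (s.+1 < n)%N.
    by rewrite -rx; apply: canonical_pair_ltn hcx _; lia.
  have ylow (k : 'I_n) : (k < s.+1)%N -> val y 0 k = 0.
    rewrite ltnS leq_eqVlt => /orP[/eqP/val_inj->|ks].
      have : val x 0 s = 1 by apply: oppr_inj; rewrite -e1 mxE.
      by rewrite e !mxE eqxx -[RHS]add0r => /addIr.
    have := xlow _ ks; rewrite e !mxE eqSS.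
    by case: eqP => [ek|_]; [lia | rewrite addr0].
  have hrow : row y = s.+2.
    apply: (@root_rowE y (Ordinal hs1)) => //.
    have : val y 0 (Ordinal hs1) = val x 0 (Ordinal hs1).
      by rewrite e !mxE /= eqSS; case: eqP => [|_]; [lia | rewrite addr0].
    move=> ->; rewrite rootE rx eps_rootE /index_iota.
    have -> : (ent x - s.+1 = (ent x - s.+3).+2)%N by lia.
    rewrite /= !big_cons /fold_index.
    have -> : (n < s.+2)%N = false by lia.
    by rewrite andbF eqxx /= addnCA.
  by rewrite hrow rx; split=> //; lia.
right; have {}e : val y = val x + simple n j.+1.
  by apply: oppr_inj; rewrite e opprD.
have hh : (ent y - row y = (ent x - row x).+1)%N.
  have := root_height y; rewrite e.
  under eq_bigr do rewrite mxE; rewrite big_split /= root_height.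
  by rewrite simple_height ?ltn_ord //; lia.
have hrow : row y = s.+1.
  apply: root_rowE => [k ks|].
    by rewrite e !mxE xlow // eqSS; case: eqP => // ek; lia.
  have x0 : 0 < val x 0 s by rewrite lt_def xs root_ge0.
  by rewrite e !mxE gt_eqF // ltr_wpDr.
by rewrite hrow rx; split=> //; lia.
Qed.

Lemma root_neg (x : root) : - val x \in neg_root tp n.
Proof. by rewrite inE opprK; apply: (valP x). Qed.

Lemma neg_rootP b : b \in neg_root tp n -> exists x : root, b = - val x.
Proof. by rewrite inE => h; exists (SeqSub h); rewrite /= opprK. Qed.

Lemma row_lt (x : root) : ((row x).-1 < n)%N.
Proof. by have /and4P[] := canonical_pair_le (root_canonical x); lia. Qed.

Lemma succ_step_entry (x y : root) :
  row y = row x -> ent y = (ent x).+1 -> succ_step tp (- val x) (- val y).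
Proof.
move=> e1 e2; have hy := root_canonical y; rewrite e1 e2 in hy.
have /and4P[x1 x2 x3 x4] := canonical_pair_le (root_canonical x).
split; [exact: root_neg | exact: root_neg |].
exists (Ordinal (row_lt x)); first by apply: row_first_index; rewrite /= prednK.
right; have /andP[h1 h2] : (row x <= fold_index tp n (ent x) <= n)%N.
  by apply: fold_index_canonical hy _; rewrite leqnn ltnW.
have hj : ((fold_index tp n (ent x)).-1 < n)%N by lia.
exists (Ordinal hj); first by rewrite /=; lia.
rewrite /= prednK; last by lia.
by rewrite !rootE e1 e2 /eps_root big_nat_recr /= ?opprD // ltnW.
Qed.

Lemma succ_step_row (x y : root) :
  row y = (row x).+1 -> ent y = ent x -> succ_step tp (- val x) (- val y).
Proof.
move=> e1 e2; have hy := root_canonical y.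
have /and4P[x1 x2 x3 x4] := canonical_pair_le (root_canonical x).
split; [exact: root_neg | exact: root_neg |].
exists (Ordinal (row_lt x)); first by apply: row_first_index; rewrite /= prednK.
have e : val x = simple n (row x) + val y.
  rewrite !rootE e1 e2 /eps_root big_ltn // /fold_index.
  by have -> : (n < row x)%N = false by [lia]; rewrite andbF.
left; rewrite /= prednK // e; split; first by rewrite opprD addrAC addNr add0r.
by rewrite !mxE /= prednK // eqxx rootE (eps_root_first hy) /= ?prednK ?e1.
Qed.

Lemma root_ltp_trans : transitive ltr.
Proof. exact: ltp_trans (@root_pair_inj tp n). Qed.

(** Conversely, to climb from [x] to [y] the entry is raised first and the row afterwards. Since
    [top_entry] decreases with the row, all intermediate pairs are canonical. *)
Lemma succ_rootP (x y : root) : succ_root tp (- val x) (- val y) <-> ltr x y.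
Proof.
split=> [|xy].
  suff h a b : succ_root tp a b -> exists u v : root,
      [/\ a = - val u, b = - val v & ltr u v].
    by case/h => u [v [/oppr_inj/val_inj-> /oppr_inj/val_inj->]].
  elim=> {a b} [a b|a b c _ [u [v [-> ->
    uv]]] _ [v' [w [/oppr_inj/val_inj ev -> vw]]]].
    move=> hab; have [/neg_rootP[u eu] /neg_rootP[v ev] _] := hab.
    exists u, v; split=> //; rewrite eu ev in hab.
    have h := succ_step_pair hab; rewrite /ltp /lep.
    have -> : u != v by apply/eqP => euv; move: h; rewrite euv; lia.
    by rewrite andbT; apply/andP; lia.
  exists u, w; split; [by [] | by [] |].
  by rewrite ev in uv; apply: root_ltp_trans uv vw.
have [k] := ubnP ((row y - row x) + (ent y - ent x)).
elim: k x xy => // k IHk x /andP[/andP[h1 h2] nxy] hk.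
have cx := root_canonical x; have cy := root_canonical y.
move: (cx) (cy); rewrite /canonical_pair => /and3P[x1 x2 x3] /and3P[y1 y2 y3].
have tle := top_entry_anti h1.
have next (u : root) : succ_step tp (- val x) (- val u) -> lep row ent u y ->
    ((row y - row u) + (ent y - ent u) < k)%N ->
      succ_root tp (- val x) (- val y).
  move=> xu uy hu; have [<-|nuy] := eqVneq u y; first exact: t_step.
  by apply: t_trans (t_step _ _ _ _ xu) (IHk _ _ hu); rewrite /ltp uy nuy.
have [h|h] := ltnP (ent x) (ent y).
  have [|u [u1 u2]] := @root_of_pair tp n (row x) (ent x).+1.
    by rewrite /canonical_pair; apply/and3P; split; lia.
  apply: (next u); first exact: succ_step_entry.
    by rewrite /lep u1 u2 h1.
  by rewrite u1 u2; lia.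
have e : ent x = ent y by lia.
have h' : (row x < row y)%N.
  by rewrite ltn_neqAle h1 andbT; apply: contraNneq nxy => e';
    apply/eqP/root_pair_inj.
have [|u [u1 u2]] := @root_of_pair tp n (row x).+1 (ent x).
  have := top_entry_anti h'.
  by rewrite /canonical_pair => ?; apply/and3P; split; lia.
apply: (next u); first exact: succ_step_row.
  by rewrite /lep u1 u2 h' e leqnn.
by rewrite u1 u2; lia.
Qed.

End DyckPaths.

(** * Dyck path inequalities as bounds on chains *)

Section Polytope.
Variables (R : realType) (tp : cartan_type) (n : nat) (m : 'I_n -> nat).
Notation root := (posroot tp n).
Notation row := (@root_row tp n).
Notation ent := (@root_entry tp n).
Notation ltr := (ltp row ent).

Definition chain_bounded (s : root -> nat) :=
  forall p i z, sorted ltr p ->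
    all (fun x => (i <= row x) && (ent x <= z))%N p ->
    (\sum_(x <- p) s x <= \sum_(k < n | i <= k.+1 < z) m k)%N.

Lemma simple_root a : (0 < a <= n)%N ->
  exists x : root, [/\ row x = a, ent x = a.+1 & val x = simple n a].
Proof.
case/andP=> a0 an; have [|x [h1 h2]] := @root_of_pair tp n a a.+1.
  by rewrite /canonical_pair /top_entry /bar a0; case: tp => /=; lia.
by exists x; rewrite (simple_eps tp) // rootE h1 h2.
Qed.

Lemma simple_rootP (x : root) a : (0 < a <= n)%N -> val x = simple n a ->
  row x = a /\ ent x = a.+1.
Proof.
by move=> /simple_root[y [<- <- <-]] /val_inj->.
Qed.

Lemma long_root (x : root) : (n.+1 < ent x)%N ->
  exists y : root, exists2 j, (row x <= j <= n)%N &
    [/\ is_C tp, row y = j, ent y = ent x & val y = croot n j j].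
Proof.
have := root_canonical x; rewrite /canonical_pair.
have [hC|hA] := boolP (is_C tp); last by rewrite /top_entry (negPf hA); lia.
rewrite {1}/top_entry hC /bar => /and3P[x1 x2 x3] xn.
have [|y [y1 y2]] := @root_of_pair tp n (n.*2.+1 - ent x) (ent x).
  by rewrite /canonical_pair /top_entry hC /bar; apply/and3P; split; lia.
exists y, (n.*2.+1 - ent x)%N; first by lia.
split=> //; rewrite (@croot_eps tp) //; last by lia.
rewrite rootE y1 y2 /bar; congr eps_root; lia.
Qed.

Lemma long_rootP (x : root) j : is_C tp -> (0 < j <= n)%N ->
  val x = croot n j j -> row x = j /\ (n < ent x)%N.
Proof.
move=> hC hj; rewrite (@croot_eps tp) // => /root_pairE[|-> ->].
  by rewrite /canonical_pair /top_entry hC /bar; apply/and3P; split; lia.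
by split=> //; rewrite /bar; lia.
Qed.

Lemma sorted_rootE p :
  sorted (fun x y : root => `[< succ_root tp (- val x) (- val y) >]) p =
  sorted ltr p.
Proof.
by apply: eq_sorted => x y; apply/asboolP/idP => /succ_rootP.
Qed.

(** The simple root of the first row is put in front. At the end comes the simple root with the last
    entry or, beyond [n + 1], the long root with that entry. Neither widens the window of the chain,
    so the Dyck inequality implies the one for the chain. *)
Lemma dyck_extension p x : sorted ltr (x :: p) ->
  exists q st en, [/\ @dyck_path tp n q st en, {subset x :: p <= q} &
     forall i z, (i <= row x)%N -> (ent (last x p) <= z)%N ->
       forall k, (st <= k <= en)%N -> (i <= k < z)%N].
Proof.
move=> sp; set y := last x p.
have cx := root_canonical x; have cy := root_canonical y.
move: (canonical_pair_le cx) (canonical_pair_le cy) => /and4P[x1 x2 x3 _]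
  /and4P[y1 y2 y3 _].
have trans := @root_ltp_trans tp n.
have [a [a1 a2 a3]] := @simple_root (row x) ltac:(lia).
have ax : a = x \/ ltr a x.
  have [->|nax] := eqVneq a x; [by left | right].
  by rewrite /ltp /lep a1 a2 nax leqnn x3.
have [q [q1 q2 q3 q4]] : exists q, [/\ sorted ltr (a :: q),
    {subset x :: p <= a :: q}, last a q = y & val a = simple n (row x)].
  case: ax => [e|ax].
    by rewrite e in a3 *; exists p; split.
  exists (x :: p); split=> //=; first by rewrite ax.
  by move=> u up; rewrite in_cons up orbT.
have close b en : y = b \/ ltr y b ->
    ((1 <= en <= n)%N /\ val b = simple n en) \/
    [/\ is_C tp, en = n & exists2 j, (1 <= j <= n)%N & val b = croot n j j] ->
    exists2 q', @dyck_path tp n q' (row x) en & {subset x :: p <= q'}.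
  case=> [<-|yb] hb.
    by exists (a :: q) => //; exists a, q; rewrite sorted_rootE q3;
      split=> //; rewrite x1 x2.
  exists (a :: rcons q b); last first.
    by move=> u /q2; rewrite -rcons_cons mem_rcons inE => ->; rewrite orbT.
  exists a, (rcons q b); rewrite sorted_rootE last_rcons; split=> //;
    last by rewrite x1 x2.
  by move: q1; rewrite /= rcons_path q3 yb => ->.
(* The limit is [n + 1] because the simple root of index [n] has the entry [n + 1] in both types. *)
have [h|h] := leqP (ent y) n.+1.
  have [b [b1 b2 b3]] := @simple_root (ent y).-1 ltac:(lia).
  have [||q' hq' sub] := close b (ent y).-1.
  - have [->|nyb] := eqVneq y b; [by left | right].
    by rewrite /ltp /lep b1 b2 nyb; apply/andP; split=> //; lia.
  - by left; split=> //; lia.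
  by exists q', (row x), (ent y).-1; split=> // i z hi hz k; lia.
have [b [j hj [hC b1 b2 b3]]] := long_root h.
have [||q' hq' sub] := close b n.
- have [->|nyb] := eqVneq y b; [by left | right].
  by rewrite /ltp /lep b1 b2 nyb leqnn; lia.
- by right; split=> //; exists j => //; lia.
by exists q', (row x), n; split=> // i z hi hz k; lia.
Qed.

Lemma chain_window x p u : sorted ltr (x :: p) -> u \in x :: p ->
  lep row ent x u /\ lep row ent u (last x p).
Proof.
have trans := @root_ltp_trans tp n.
move=> sp up; split.
  move: up; rewrite inE => /orP[/eqP->|up]; first by rewrite /lep !leqnn.
  by have /allP/(_ u up)/andP[] := order_path_min trans sp.
move: up sp; rewrite lastI mem_rcons inE => /orP[/eqP->|up];
  first by rewrite /lep !leqnn.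
by rewrite (sorted_rcons (@root_pair_inj tp n)) => /andP[/allP/(_ u up)/andP[]].
Qed.

Lemma chain_uniq p : sorted ltr p -> uniq p.
Proof.
by apply: sorted_uniq => [|x];
  [apply: root_ltp_trans | rewrite /ltp eqxx andbF].
Qed.

Lemma sum_subset (s : root -> nat) p q : uniq p -> uniq q -> {subset p <= q} ->
  (\sum_(x <- p) s x <= \sum_(x <- q) s x)%N.
Proof.
move=> up uq sub; rewrite big_uniq // [leqRHS]big_uniq // big_mkcond
  [leqRHS]big_mkcond.
by apply: leq_sum => x _; case: ifP => // /sub->.
Qed.

Lemma polytope_chain (s : {ffun root -> nat}) :
  @FFLV_polytope R tp n m [ffun a => (s a)%:R] <-> chain_bounded s.
Proof.
have sumE p : \sum_(a <- p) [ffun a => (s a)%:R : R] a = (\sum_(a <- p) s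
  a)%N%:R.
  by rewrite natr_sum; apply: eq_bigr => a _; rewrite ffunE.
split=> [[_ bnd] [|x p] i z sp allp|bnd]; first by rewrite big_nil.
- have [q [st [en [hq sub hwin]]]] := dyck_extension sp.
  have := bnd _ _ _ hq; rewrite sumE ler_nat => hle.
  have uq : uniq q by case: hq => [b [q' [_]]];
    rewrite sorted_rootE => /chain_uniq.
  apply: leq_trans (leq_trans (sum_subset s (chain_uniq sp) uq sub) hle) _.
  rewrite big_mkcond [leqRHS]big_mkcond; apply: leq_sum => k _.
  have /andP[ix _] : (i <= row x)%N && (ent x <= z)%N by apply: (allP allp);
    rewrite inE eqxx.
  have /andP[_ yz] := allP allp _ (mem_last x p).
  by case: ifP => // /(hwin _ _ ix yz)->.
split=> [a|p st en]; first by rewrite ffunE ler0n.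
case=> [x [p' [-> sp [hst hx] hy]]]; rewrite sumE ler_nat.
rewrite sorted_rootE in sp; have [rx _] := simple_rootP hst hx.
(* After a simple root the window ends at [e(p) + 1]. After a long root [e(p) = n], so any upper end
   is harmless. *)
have [z hz hzk] : exists2 z, (ent (last x p') <= z)%N &
    forall k : 'I_n, (k.+1 < z)%N -> (k.+1 <= en)%N.
  case: hy => [[hen /(simple_rootP hen)[_ ->]]|[hC -> [j hj /long_rootP h]]].
    by exists en.+1.
  by exists (ent (last x p')).
have allp : all (fun u => (st <= row u)%N && (ent u <= z)%N) (x :: p').
  apply/allP => u /(chain_window sp)[/andP[h1 _] /andP[_ h2]].
  by rewrite -rx h1 (leq_trans h2 hz).
apply: leq_trans (bnd _ _ _ sp allp) _.
rewrite big_mkcond [leqRHS]big_mkcond; apply: leq_sum => k _.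
by case: ifP => // /andP[-> /hzk ->].
Qed.

End Polytope.

(** * Tableaux *)

Section Shape.
Variables (n : nat) (m : 'I_n -> nat).
Notation L := (part m 1).
Notation mu := (fun c => col_length m c.+1).

Lemma part_recl k (hk : (k < n)%N) :
  part m k.+1 = (m (Ordinal hk) + part m k.+2)%N.
Proof.
rewrite /part (bigD1 (Ordinal hk)) //=; congr addn.
by apply: eq_bigl => i; rewrite -val_eqE /=; lia.
Qed.

Lemma part_anti k l : (k <= l)%N -> (part m l <= part m k)%N.
Proof.
move=> kl; rewrite /part big_mkcond [leqRHS]big_mkcond; apply: leq_sum => i _.
by case: ifP => // h; rewrite ifT //; lia.
Qed.

Lemma part_eq0 k : (n < k)%N -> part m k = 0%N.
Proof. by move=> nk; rewrite /part big1 // => i hi; have := ltn_ord i; lia. Qed.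

Lemma sum_ord_ltn N k : (k <= N)%N -> (\sum_(i < N) (i < k) = k)%N.
Proof.
move=> kN; under eq_bigr do rewrite -[nat_of_bool _]/(if _ then 1%N else 0%N).
by rewrite -big_mkcond -(big_ord_widen N (fun=> 1%N)) // sum1_card card_ord.
Qed.

Lemma card_ord_ltn k : (k <= n)%N -> #|[pred i : 'I_n | (i < k)%N]| = k.
Proof. by move/sum_ord_ltn => {2}<-; rewrite -sum1_card big_mkcond. Qed.

Lemma card_down_set (D : pred 'I_n) :
    (forall i j : 'I_n, (i <= j)%N -> D j -> D i) ->
  forall i, D i = (i < #|D|)%N.
Proof.
move=> down i; apply/idP/idP => [Di|].
  rewrite -[leqLHS](card_ord_ltn (ltn_ord i)); apply: subset_leq_card.
  by apply/fintype.subsetP => j; rewrite !inE => ji; apply: down Di.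
apply: contraTT => nDi; rewrite -leqNgt -[leqRHS](card_ord_ltn (ltnW (ltn_ord
  i))).
apply: subset_leq_card; apply/fintype.subsetP => j Dj; rewrite inE ltnNge.
by apply: contraNN nDi => ij; apply: down ij Dj.
Qed.

Lemma box_inj (b b' : box m) : brow b = brow b' -> bcol b = bcol b' -> b = b'.
Proof.
case: b b' => [[i j] h] [[i' j'] h']; rewrite /brow /bcol /= => -[e1] [e2].
by apply: val_inj; congr pair; apply: val_inj.
Qed.

Lemma bcol_le (b : box m) : (0 < bcol b <= L)%N.
Proof. by rewrite /bcol ltn_ord. Qed.

Lemma brow_le (b : box m) : (0 < brow b <= n)%N.
Proof. by rewrite /brow ltn_ord. Qed.

Lemma box_exists r c : (0 < r)%N -> (0 < c <= part m r)%N ->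
  exists b : box m, brow b = r /\ bcol b = c.
Proof.
move=> r0 /andP[c0 cr].
have rn : (r.-1 < n)%N.
  by rewrite prednK // leqNgt; apply/negP => /part_eq0 e; lia.
have cL : (c.-1 < L)%N by have := part_anti r0; lia.
have h : ((Ordinal cL).+1 <= part m (Ordinal rn).+1)%N by rewrite /= !prednK.
by exists (exist _ (Ordinal rn, Ordinal cL) h); rewrite /brow /bcol /= !prednK.
Qed.

Lemma brow_part (b : box m) : (bcol b <= part m (brow b))%N.
Proof. exact: (valP b). Qed.

(** Both sides say that [(r, c)] is a box: as [part] is nonincreasing, the rows that meet column [c]
    form an initial segment. *)
Lemma col_lengthE c r : (0 < c)%N -> (0 < r)%N ->
  (r <= col_length m c)%N = (c <= part m r)%N.
Proof.
move=> c0 r0.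
have e : col_length m c = #|[pred i : 'I_n | (c <= part m i.+1)%N]|.
  rewrite /col_length -(card_in_imset (f := fun b : box m => (val b).1)).
    apply: eq_card => i; rewrite inE; apply/imsetP/idP => [[b]|ci].
      by rewrite inE => /eqP <- ->; apply: brow_part.
    have [|b [b1 b2]] := @box_exists i.+1 c isT; first by rewrite c0.
    by exists b; rewrite ?inE ?b2 //; apply: val_inj; case: b1.
  move=> b b'; rewrite !inE => /eqP h /eqP h' eb; apply: box_inj;
    last by rewrite h h'.
  by rewrite /brow eb.
have [rn|rn] := leqP r n; last first.
  rewrite part_eq0 // [RHS]leqn0 [RHS]gtn_eqF //; apply/negbTE.
  by rewrite -ltnNge e (leq_ltn_trans (max_card _)) ?card_ord.
have hr : (r.-1 < n)%N by lia.
have := @card_down_set [pred i : 'I_n | (c <= part m i.+1)%N] _ (Ordinal hr).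
rewrite /= prednK // e => ->//.
by move=> i j ij h; apply: leq_trans h (part_anti _).
Qed.

Lemma brow_col (b : box m) : (brow b <= col_length m (bcol b))%N.
Proof.
have /andP[h _] := brow_le b; have /andP[h' _] := bcol_le b.
by rewrite col_lengthE // brow_part.
Qed.

Lemma col_box r c : (0 < c)%N -> (0 < r <= col_length m c)%N ->
  exists b : box m, brow b = r /\ bcol b = c.
Proof.
by move=> c0 /andP[r0]; rewrite col_lengthE // => h; apply: box_exists;
  rewrite ?c0.
Qed.

Lemma mu_anti c d : (c <= d)%N -> (col_length m d.+1 <= col_length m c.+1)%N.
Proof.
move=> cd; case: (posnP (col_length m d.+1)) => [->//|pos].
by rewrite col_lengthE // (leq_ltn_trans cd) // -col_lengthE.
Qed.

Lemma col_length_le c : (col_length m c.+1 <= n)%N.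
Proof. by rewrite leqNgt col_lengthE // part_eq0. Qed.

(** [m_k = lambda_k - lambda_(k+1)] is the number of columns of length [k]. *)
Lemma slotsE i z : slots mu L 0 i z = (\sum_(k < n | i <= k.+1 < z) m k)%N.
Proof.
have mE k : m k = (\sum_(c < L) (mu c == k.+1))%N.
  have h := part_recl (ltn_ord k).
  have le1 := @part_anti 1 k.+1 isT; have le2 := @part_anti 1 k.+2 isT.
  have : (\sum_(c < L) (c < part m k.+1) =
          \sum_(c < L) (mu c == k.+1) + \sum_(c < L) (c < part m k.+2))%N.
    rewrite -big_split /=; apply: eq_bigr => c _.
    by rewrite -!col_lengthE //; case: (ltngtP (col_length m c.+1) k.+1); lia.
  rewrite !sum_ord_ltn // h => /addIn <-; congr m; exact: val_inj.
under [RHS]eq_bigr do rewrite mE.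
rewrite exchange_big /slots big_mkord; apply: eq_bigr => c _ /=.
have mun := col_length_le c.
have mu0 : (0 < mu c)%N by rewrite col_lengthE //= ltn_ord.
have hk : ((mu c).-1 < n)%N by rewrite prednK.
rewrite big_mkcond (bigD1 (Ordinal hk)) //= prednK // eqxx big1 ?addn0 => [|k].
  by case: ifP.
rewrite -val_eqE /= => hne; case: ifP => // _; case: eqP => // e.
by move: hne; rewrite e eqxx.
Qed.

End Shape.

Section Tableaux.
Variables (tp : cartan_type) (n : nat) (m : 'I_n -> nat).
Notation L := (part m 1).
Notation mu := (fun c => col_length m c.+1).
Notation root := (posroot tp n).
Notation row := (@root_row tp n).
Notation ent := (@root_entry tp n).
Notation fam := (family row ent mu L).

(* The exponent of [f_a] in the monomial attached to [T]. *)
Definition multiplicity (T : filling tp m) (a : root) : nat :=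
  #|[set b | (brow b == row a) && (entry T b == ent a)]%SET|.

(** A box whose entry is its own row number encodes nothing, since [row a < ent a] for every
    root. *)
Definition column_roots (T : filling tp m) c : pred root :=
  fun a => [exists b, [&& bcol b == c.+1, brow b == row a & entry T b == ent
    a]].

Lemma multiplicityE T a : multiplicity T a = (\sum_(c < L) column_roots T c
  a)%N.
Proof.
rewrite /multiplicity -sum1_card.
transitivity (\sum_(b : box m) \sum_(c < L)
   [&& bcol b == c.+1, brow b == row a & entry T b == ent a])%N.
  rewrite [LHS]big_mkcond; apply: eq_bigr => b _; rewrite finset.inE.
  have /andP[h1 h2] := bcol_le b;
    have hb : ((bcol b).-1 < L)%N by rewrite prednK.
  rewrite (bigD1 (Ordinal hb)) //= eqxx big1 ?addn0 => [|c].
    by case: ifP.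
  move=> hne; case: eqP => //= -[e]; case/eqP: hne.
  by apply: val_inj; rewrite /= -e.
rewrite exchange_big; apply: eq_bigr => c _ /=.
have [/existsP[b hb]|/existsPn h] := boolP (column_roots T c a); last first.
  by rewrite big1 // => b _; rewrite (negPf (h b)).
rewrite (bigD1 b) //= hb big1 // => b' nbb'; apply/eqP; rewrite eqb0.
apply: contraNN nbb' => /and3P[/eqP e1 /eqP e2 _].
by case/and3P: hb => /eqP e3 /eqP e4 _; apply/eqP/box_inj;
  rewrite ?e2 ?e4 ?e1 ?e3.
Qed.

Lemma natdimE : natdim tp n = if is_C tp then n.*2 else n.+1.
Proof. by case: tp. Qed.

Lemma entry_le (T : filling tp m) b : (0 < entry T b <= natdim tp n)%N.
Proof. by rewrite /entry ltn_ord. Qed.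

(* By induction on the row, condition (iv) amounts to the absence of the entries
   [\bar j] with [j < i] in row [i]. *)
Lemma sst_canonical (T : filling tp m) b : PBW_semistandard T ->
  entry T b <> brow b -> canonical_pair tp n (brow b) (entry T b).
Proof.
move=> [h1 h2 _ h4]; have [k] := ubnP (brow b); elim: k b => // k IHk b hk hb.
have /andP[r0 rn] := brow_le b; have /andP[t0 tN] := entry_le T b.
have hmu : (col_length m (bcol b) < entry T b)%N.
  by rewrite ltnNge; apply/negP => /h1.
have hr := brow_col b.
rewrite /canonical_pair r0 (leq_ltn_trans hr hmu) /top_entry /=.
move: h4 tN; case: ifP => [hC|hA] h4; last by rewrite natdimE hA.
rewrite natdimE hC => tN; rewrite leqNgt; apply/negP => hlt.
(* Too large an entry is [\bar r] for an earlier row [r]. In that row of the same column, an entry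
   [r] contradicts (iv), and any other entry exceeds [\bar r] by (ii), against the induction
   hypothesis. *)
pose r := bar n (entry T b).
have r_lt : (r < brow b)%N by move: hlt; rewrite /r /bar; lia.
have r_gt0 : (0 < r)%N by rewrite /r /bar; lia.
have [||b' [b1 b2]] := @col_box n m r (bcol b).
- by have /andP[] := bcol_le b.
- by rewrite r_gt0 (leq_trans (ltnW r_lt) hr).
have [e|/eqP ne] := eqVneq (entry T b') (brow b').
  have := h4 isT b' b b2 e; rewrite b1 /r /bar => /(_ ltac:(lia)).
  by move: r_lt; rewrite /r /bar; lia.
have := h2 b' b b2; rewrite b1 => /(_ r_lt); rewrite -b1 => /(_ ne) hlt'.
have : canonical_pair tp n (brow b') (entry T b') by apply: IHk => //; lia.
rewrite /canonical_pair /top_entry hC b1 => /and3P[_ _].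
by move: hlt'; rewrite /r /bar; lia.
Qed.

Lemma sst_root (T : filling tp m) b : PBW_semistandard T ->
  entry T b <> brow b -> exists a : root, row a = brow b /\ ent a = entry T b.
Proof. by move=> hT hb; apply: root_of_pair; apply: sst_canonical. Qed.

Lemma row_lt_ent (a : root) : (row a < ent a)%N.
Proof. by have /and3P[] := root_canonical a. Qed.

(** Conditions (i), (ii), (iii) become eligibility, the antichain property and domination. The box
    provided by (iii) has an entry larger than the length of its column, so it does encode a
    root. *)
Lemma sst_family T : PBW_semistandard T -> fam (column_roots T).
Proof.
move=> hT; have [h1 h2 h3 _] := hT.
split=> [c a cL /existsP[b /and3P[/eqP e1 /eqP e2 /eqP e3]]|c a a' cL|c a cL].
- rewrite -e2 -e3 -e1 brow_col ltnNge; apply/negP => /h1.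
  by rewrite e2 e3 => e; have := row_lt_ent a; lia.
- case/existsP=> b /and3P[/eqP e1 /eqP e2 /eqP e3].
  case/existsP=> b' /and3P[/eqP e1' /eqP e2' /eqP e3'].
  apply/negP => /andP[/andP[ler lee] /eqP]; apply; apply: root_pair_inj.
    apply/eqP; rewrite eqn_leq ler leqNgt; apply/negP => lt.
    have := h2 b b'; rewrite e1 e1' e2 e2' e3 e3' => /(_ (erefl _) lt).
    by have := row_lt_ent a; lia.
  have [e|lt] := leqP (row a') (row a).
    have er : row a = row a' by lia.
    have eb : b = b' by apply: box_inj; rewrite ?e1 ?e1' // e2 e2' er.
    by rewrite -e3 -e3' eb.
  have := h2 b b'; rewrite e1 e1' e2 e2' e3 e3' => /(_ (erefl _) lt).
  by have := row_lt_ent a; lia.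
case/existsP=> b /and3P[/eqP e1 /eqP e2 /eqP e3] hmu.
have [|b' [b1 b2 b3]] := h3 b; first by rewrite e1.
have eb' : bcol b' = c.+1 by apply: succn_inj; rewrite b1 e1.
have hb' := brow_col b'; rewrite eb' in hb'.
have [|a' [a1 a2]] := @sst_root T b' hT; first by lia.
exists a'; last by rewrite /lep a1 a2 -e2 -e3 b2.
by apply/existsP; exists b'; rewrite eb' a1 a2 !eqxx.
Qed.

Lemma multiplicity_inj T T' : PBW_semistandard T -> PBW_semistandard T' ->
  multiplicity T =1 multiplicity T' -> T = T'.
Proof.
move=> hT hT' e.
have eqcol c : (c < L)%N -> column_roots T c =1 column_roots T' c.
  apply: (family_inj (@root_pair_inj tp n) (@mu_anti n m)) => [| |a];
    try exact: sst_family.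
  by rewrite -!multiplicityE e.
have aux U U' b : PBW_semistandard U ->
    (forall c, (c < L)%N -> column_roots U c =1 column_roots U' c) ->
    entry U b <> brow b -> entry U b = entry U' b.
  move=> hU eUU' hb; have [a [a1 a2]] := sst_root hU hb.
  have /andP[c0 cL] := bcol_le b.
  have : column_roots U (bcol b).-1 a.
    by apply/existsP; exists b; rewrite prednK // a1 a2 !eqxx.
  rewrite eUU'; last by rewrite prednK.
  case/existsP=> b'; rewrite prednK // => /and3P[/eqP e1 /eqP e2 /eqP e3].
  by rewrite -a2 -e3; congr entry; apply: box_inj => //; rewrite -a1.
apply/ffunP => b; apply: val_inj; apply: succn_inj; rewrite -!/(entry _ b).
have [e1|/eqP ne1] := eqVneq (entry T b) (brow b); last exact: aux.
have [e2|/eqP ne2] := eqVneq (entry T' b) (brow b); first by rewrite e1 e2.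
by apply/esym/aux => // c cL a; rewrite eqcol.
Qed.

Lemma multiplicity_chain_bounded T : PBW_semistandard T ->
  chain_bounded m (multiplicity T).
Proof.
move=> /sst_family hT p i z sp allp; rewrite -slotsE.
under eq_bigr do rewrite multiplicityE.
exact: (family_bounded (@root_pair_inj tp n) hT) sp allp.
Qed.

End Tableaux.

(** * The tableau of a lattice point, and permissibility as a support condition *)

Section Existence.
Variables (tp : cartan_type) (n : nat) (m : 'I_n -> nat).
Notation L := (part m 1).
Notation mu := (fun c => col_length m c.+1).
Notation root := (posroot tp n).
Notation row := (@root_row tp n).
Notation ent := (@root_entry tp n).

Lemma leq_natdim : (n <= natdim tp n)%N.
Proof. by rewrite natdimE; case: is_C; lia. Qed.

(** The tableau of the highest weight vector; it serves both as a default value and as the reference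
    assignment in the tensor power. *)
Definition row_tableau : filling tp m :=
  [ffun b => widen_ord leq_natdim (val b).1].

Lemma entry_row_tableau b : entry row_tableau b = brow b.
Proof. by rewrite /entry ffunE. Qed.

(** An antichain has at most one root in each row; its entry goes into that row of the greedy
    column, and the boxes left over receive their row number. *)
Lemma tableau_exists (s : root -> nat) : chain_bounded m s ->
  exists2 T : filling tp m, PBW_semistandard T & multiplicity T =1 s.
Proof.
move=> bs; have {}bs : bounded row ent mu L 0 s.
  by move=> p i z sp allp; rewrite slotsE; apply: bs.
have inj := @root_pair_inj tp n.
have famG := greedy_family inj (@mu_anti n m) bs;
  set G := greedy _ _ _ _ in famG.
have [elig anti dom] := famG.
have uniqG c a a' : (c < L)%N -> G c a -> G c a' -> row a = row a' -> a = a'.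
  move=> cL Ga Ga' e.
  wlog le : a a' Ga Ga' e / (ent a <= ent a')%N.
    move=> h; case: (leqP (ent a) (ent a')) => [|/ltnW] le; first exact: h.
    by apply/esym/h.
  apply/eqP; rewrite -[_ == _]negbK; apply: contra (anti _ _ _ cL Ga Ga') => ne.
  by rewrite /ltp /lep e leqnn le.
pose v (b : box m) := if [pick a | G (bcol b).-1 a && (row a == brow b)] is
  Some a
  then ent a else brow b.
(* [v b] lies between 1 and [natdim tp n], so the default of [insubd] never occurs; the predecessor
   is due to ordinals starting at 0. *)
pose T : filling tp m := [ffun b => insubd (row_tableau b) (v b).-1].
have colL (b : box m) : ((bcol b).-1 < L)%N by have /andP[? ?] := bcol_le b;
  rewrite prednK.
have colK (b : box m) : (bcol b).-1.+1 = bcol b by [].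
have TE b : entry T b = v b.
  have hv : (0 < v b <= natdim tp n)%N.
    rewrite /v; case: pickP => [a _|_].
      by have /and4P[? ? ? ->] := canonical_pair_le (root_canonical a); lia.
    by have /andP[-> h] := brow_le b; rewrite (leq_trans h leq_natdim).
  by case/andP: hv => hv1 hv2;
    rewrite /entry ffunE val_insubd prednK // hv2 prednK.
have Tin b a : G (bcol b).-1 a -> row a = brow b -> entry T b = ent a.
  move=> Ga ra; rewrite TE /v; case: pickP => [a' /andP[Ga' /eqP ra']|/(_ a)].
    by rewrite (uniqG _ _ _ (colL b) Ga Ga') // ra ra'.
  by rewrite Ga ra eqxx.
have Tcase b : entry T b <> brow b ->
    exists a, [/\ G (bcol b).-1 a, row a = brow b & entry T b = ent a].
  by rewrite TE /v; case: pickP => // a /andP[Ga /eqP ra] _; exists a.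
have Tge b : (brow b <= entry T b)%N.
  have [->//|/eqP/Tcase[a [_ <- ->]]] := eqVneq (entry T b) (brow b).
  exact/ltnW/row_lt_ent.
have Telig b : entry T b <> brow b -> (col_length m (bcol b) < entry T b)%N.
  by case/Tcase=> a [Ga _ ->]; have /andP[_] := elig _ _ (colL b) Ga;
    rewrite colK.
exists T; last first.
  move=> a; rewrite multiplicityE -(sum_greedy inj (@mu_anti n m) bs).
  apply: eq_bigr => c _; congr nat_of_bool; apply/existsP/idP => [[b]|Ga].
    case/and3P => /eqP e1 /eqP e2 /eqP e3.
    have [|a' [Ga' ra' ea']] := Tcase b; first by have := row_lt_ent a; lia.
    by rewrite -(inj a' a); [rewrite e1 in Ga' | rewrite ra' | rewrite -ea'].
  have /andP[h1 h2] := elig _ _ (ltn_ord c) Ga.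
  have /and3P[r0 _ _] := root_canonical a.
  have [||b [b1 b2]] := @col_box n m (row a) c.+1; rewrite ?r0 //.
  by exists b; rewrite b1 b2 !eqxx (Tin b a) ?b2 //=.
split.
- move=> b hb; apply/eqP/negPn/negP => /eqP/Telig; lia.
- move=> b b' ecol lt /Tcase[a [Ga ra ea]]; rewrite ea.
  have hmu : (col_length m (bcol b) < ent a)%N by rewrite -ea; apply: Telig;
    rewrite ea -ra; have := row_lt_ent a; lia.
  have [->|/eqP/Tcase[a' [Ga' ra' ->]]] := eqVneq (entry T b') (brow b').
    by apply: leq_ltn_trans hmu; rewrite ecol brow_col.
  rewrite ltnNge; apply/negP => le.
  rewrite -ecol in Ga'; have /negP := anti _ _ _ (colL b) Ga Ga'; apply.
  rewrite /ltp /lep le ra ra' (ltnW lt) /=.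
  by apply/eqP => e; move: lt; rewrite -ra -ra' e ltnn.
(* Condition (iii). The witness in the preceding column is the box in the same row if [b] holds its
   row number, the box in row [ent a] if that row exists there (no entry is smaller than its row),
   and otherwise the box of a dominating root. *)
- move=> b; case ec : (bcol b) => [|[|c]] // _.
  have /andP[_ cL] := bcol_le b; rewrite ec in cL.
  have /andP[r0 rn] := brow_le b.
  have hmu : (brow b <= col_length m c.+1)%N.
    by apply: leq_trans (brow_col b) _; rewrite ec mu_anti.
  have [|b0 [r1 c1]] := @col_box n m (brow b) c.+1 isT; first by rewrite r0.
  have [e|/eqP/Tcase[a [Ga ra ea]]] := eqVneq (entry T b) (brow b).
    by exists b0; rewrite r1 c1 e leqnn; split=> //; rewrite -r1 Tge.
  rewrite ec /= in Ga.
  have lt := row_lt_ent a.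
  have [h|h] := leqP (ent a) (col_length m c.+1).
    have [|b1 [r2 c2]] := @col_box n m (ent a) c.+1 isT; first by rewrite h;
      lia.
    by exists b1; rewrite r2 c2 ea -ra; split=> //; [lia | rewrite -r2 Tge].
  have [a' Ga' /andP[h1 h2]] := dom _ _ cL Ga h.
  have /andP[h3 h4] := elig _ _ (ltnW cL) Ga'.
  have [|b1 [r2 c2]] := @col_box n m (row a') c.+1 isT; first by rewrite h3;
    lia.
  exists b1; rewrite (Tin b1 a') ?c2 // r2 ea; split=> //.
  by rewrite -ra.
(* Condition (iv). Canonicity bounds an entry in row [r'] by [\bar r'], so [\bar r] in a row
   [r' >= r] means [r' = r]; one box would then contain both [r] and [\bar r]. *)
move=> hC b b' ecol e1 e2; rewrite ltnNge; apply/negP => le.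
have [e|/eqP/Tcase[a [Ga ra ea]]] := eqVneq (entry T b') (brow b').
  by have := brow_le b; have := brow_le b'; move: e2; rewrite e /bar; lia.
have /and3P[_ _] := root_canonical a; rewrite /top_entry hC ra -ea e2 /bar.
have := brow_le b; have := brow_le b'.
suff : brow b <> brow b' by lia.
move=> er; move: e1 e2; rewrite (box_inj er ecol) /bar => ->.
by have := brow_le b; lia.
Qed.

(** By (i), an entry different from its row exceeds the column length, so the proviso in (a) holds
    for every box that encodes a root. In type C, entries up to [n] fall under (a) and larger ones
    under (b). *)
Lemma permissibleP (A : {pred 'rV[int]_n}) (T : filling tp m) :
  PBW_semistandard T ->
  permissible A T <-> forall a : root, - val a \notin A ->
    multiplicity T a = 0%N.
Proof.
move=> hT; have [h1 _ _ _] := hT; split=> [[hA hC] a naA|h0].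
  apply/eqP; rewrite cards_eq0; apply/eqP/setP => b; rewrite !finset.inE.
  apply/negP => /andP[/eqP e1 /eqP e2].
  have hab := root_canonical a; have := hab.
  rewrite /canonical_pair => /and3P[r0 lt le].
  have hmu : (col_length m (bcol b) < entry T b)%N.
    by rewrite ltnNge; apply/negP => /h1; lia.
  have eA : (ent a <= n.+1)%N -> val a = aroot n (row a) (ent a).-1.
    by move=> h; rewrite rootE (@aroot_eps tp) ?prednK //; lia.
  have [C|nC] := boolP (is_C tp); last first.
    apply: (hA (row a) (ent a).-1 _ _ _ b e1); rewrite ?(negPf nC).
    - by lia.
    - by move: le; rewrite /top_entry (negPf nC); lia.
    - by rewrite -eA //; move: le; rewrite /top_entry (negPf nC).
    - by lia.
    - by rewrite prednK //; lia.
  move: le; rewrite /top_entry C /bar => le.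
  have [hn|hn] := leqP (ent a) n.
    apply: (hA (row a) (ent a).-1 _ _ _ b e1); rewrite ?C; try lia.
    by rewrite -eA //; lia.
  apply: (hC C (row a) (bar n (ent a)) _ _ _ b e1); rewrite /bar; try lia.
  rewrite (@croot_eps tp) //; try lia.
  suff -> : bar n (n.*2.+1 - ent a) = ent a by rewrite -rootE.
  by rewrite /bar; lia.
have key i y : canonical_pair tp n i y -> - eps_root tp n i y \notin A ->
    forall b : box m, brow b = i -> entry T b <> y.
  case/root_of_pair => a [<- <-]; rewrite -rootE => /h0/eqP.
  rewrite cards_eq0 => /eqP/setP h b e1 e2.
  by have := h b; rewrite !finset.inE e1 e2 !eqxx.
split=> [i j ij hj naA b bi bj|C i j ij hj naA b bi].
  apply: (key i) bi; rewrite -?aroot_eps //; last by move: hj; case: is_C; lia.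
  by rewrite /canonical_pair /top_entry /bar; move: hj; case: is_C => hj;
    apply/and3P; split; lia.
apply: (key i) bi; rewrite -?croot_eps //; last 2 first.
- by lia.
- by lia.
by rewrite /canonical_pair /top_entry C /bar; apply/and3P; split; lia.
Qed.

End Existence.

(** * Tensor powers *)

Section TensorPower.
Variables (F : numClosedFieldType) (B : finType) (N : nat).
Notation assignment := {ffun B -> 'I_N}.
(* The tensor power of [F^N] indexed by [B], in coordinates. *)
Notation tensor := {ffun {ffun B -> 'I_N} -> F^o}.
Implicit Types (G : assignment) (u : tensor) (x y : 'M[F]_N).

Definition update G b j : assignment :=
  [ffun b' => if b' == b then j else G b'].

(** The derivation action: the matrix acts on one tensor factor, summed over all factors. *)
Definition tact x u : tensor :=
  [ffun G : assignment => \sum_b \sum_j x (G b) j * u (update G b j)].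

Lemma update_update G b j j' : update (update G b j) b j' = update G b j'.
Proof. by apply/ffunP => b'; rewrite !ffunE; case: eqP. Qed.

Lemma update_comm G b b' j j' : b != b' ->
  update (update G b j) b' j' = update (update G b' j') b j.
Proof.
move=> ne; apply/ffunP => a; rewrite !ffunE.
by case: eqP => // ->; rewrite eq_sym (negPf ne).
Qed.

Lemma update_id G b : update G b (G b) = G.
Proof. by apply/ffunP => b'; rewrite ffunE; case: eqP => // ->. Qed.

Lemma tact_linear x c u u' : tact x (c *: u + u') = c *: tact x u + tact x u'.
Proof.
apply/ffunP => G; rewrite !ffunE scaler_sumr -big_split; apply: eq_bigr => b _.
rewrite /= scaler_sumr -big_split; apply: eq_bigr => j _.
by rewrite !ffunE /= mulrDr; congr (_ + _); rewrite mulrCA.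
Qed.

Lemma tact_linearl c x y u : tact (c *: x + y) u = c *: tact x u + tact y u.
Proof.
apply/ffunP => G; rewrite !ffunE scaler_sumr -big_split; apply: eq_bigr => b _.
rewrite /= scaler_sumr -big_split; apply: eq_bigr => j _.
by rewrite !mxE mulrDl /=; congr (_ + _); rewrite -mulrA.
Qed.

(** The part of a composite action in which the two matrices hit different factors; it is symmetric
    in them, so it cancels in commutators. *)
Definition cross x y u G : F := \sum_b \sum_(b' | b' != b) \sum_j \sum_j'
  x (G b) j * (y (G b') j' * u (update (update G b j) b' j')).

Lemma cross_comm x y u G : cross x y u G = cross y x u G.
Proof.
rewrite /cross (exchange_big_dep predT) //=; apply: eq_bigr => b _.
apply: eq_big => [b'|b' ne]; first by rewrite eq_sym.
rewrite exchange_big; apply: eq_bigr => j _; apply: eq_bigr => j' _ /=.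
by rewrite mulrCA update_comm // eq_sym.
Qed.

Lemma tact_mul x y u G :
  tact x (tact y u) G = tact (x *m y) u G + cross x y u G.
Proof.
rewrite !ffunE -big_split; apply: eq_bigr => b _ /=.
transitivity (\sum_j (\sum_j' x (G b) j * (y j j' * u (update G b j')) +
   \sum_(b' | b' != b) \sum_j' x (G b) j * (y (G b') j' * u (update (update G
     b j) b' j')))).
  apply: eq_bigr => j _; rewrite ffunE (bigD1 b) //= mulrDr; congr (_ + _).
    rewrite mulr_sumr; apply: eq_bigr => j' _.
    by rewrite ffunE eqxx update_update.
  rewrite mulr_sumr; apply: eq_bigr => b' nb; rewrite mulr_sumr.
  by apply: eq_bigr => j' _; rewrite [update G b j b']ffunE (negPf nb).
rewrite big_split /=; congr (_ + _); last by rewrite exchange_big.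
rewrite exchange_big; apply: eq_bigr => j' _ /=.
by rewrite mxE mulr_suml; apply: eq_bigr => j _; rewrite mulrA.
Qed.

Lemma tact_bracket x y u :
  tact (bracket x y) u = tact x (tact y u) - tact y (tact x u).
Proof.
have -> : bracket x y = (-1) *: (y *m x) + x *m y by rewrite scaleN1r addrC.
rewrite tact_linearl; apply/ffunP => G.
have lhsE (v w : tensor) : ((-1) *: v + w) G = w G - v G.
  by rewrite !ffunE scaleN1r addrC.
have rhsE (v w : tensor) : (v - w) G = v G - w G by rewrite !ffunE.
rewrite lhsE rhsE !tact_mul [cross y x u G]cross_comm.
by rewrite opprD addrACA subrr addr0.
Qed.

Definition inner u u' : F := \sum_G u G * (u' G)^*.

Definition adjoint x : 'M[F]_N := \matrix_(i, j) (x j i)^*.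

Lemma inner_tact x u u' : inner (tact x u) u' = inner u (tact (adjoint x) u').
Proof.
rewrite /inner.
under eq_bigr do rewrite ffunE mulr_suml.
under [RHS]eq_bigr do rewrite ffunE rmorph_sum mulr_sumr.
rewrite exchange_big [RHS]exchange_big; apply: eq_bigr => b _ /=.
under eq_bigr do rewrite mulr_suml.
under [RHS]eq_bigr do rewrite rmorph_sum mulr_sumr.
rewrite !pair_big /=.
(* Exchanging the written value with the overwritten one is an involution that swaps source and
   target of a matrix entry. *)
pose h (p : assignment * 'I_N) := (update p.1 b p.2, p.1 b).
have hK : involutive h.
  by case=> G j; rewrite /h /= update_update update_id ffunE eqxx.
rewrite (reindex_inj (inv_inj hK)); apply: eq_bigr => -[G j] _ /=.
rewrite update_update update_id !ffunE eqxx mxE rmorphM /= conjCK.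
by rewrite -mulrA mulrCA.
Qed.

Lemma inner_linear c u u' v : inner (c *: u + u') v = c * inner u v + inner u'
  v.
Proof.
rewrite /inner mulr_sumr -big_split; apply: eq_bigr => G _.
by rewrite !ffunE mulrDl -mulrA.
Qed.

Lemma inner_eq0 u : inner u u = 0 -> u = 0.
Proof.
move=> /eqP; rewrite psumr_eq0 => [|G _]; last exact: mul_conjC_ge0.
move=> /allP h; apply/ffunP => G; rewrite ffunE; apply/eqP.
by rewrite -mul_conjC_eq0 (eqP (h G _)) ?mem_index_enum.
Qed.

Variables (col : B -> nat) (r0 : B -> 'I_N).
Hypothesis box_inj : forall b b', col b = col b' -> r0 b = r0 b' -> b = b'.

Definition col_perm (s : {perm B}) : bool := [forall b, col (s b) == col b].

Lemma col_permP (s : {perm B}) : reflect (forall b, col (s b) = col b)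
  (col_perm s).
Proof. exact: eqfunP. Qed.

(** The tensor product over the columns of the wedges of their row vectors, in coordinates. *)
Definition alternating : tensor :=
  [ffun G : assignment =>
     \sum_(s : {perm B} | col_perm s && (G == [ffun b => r0 (s b)])) (-1) ^+ s].

Lemma alternating_swap G b b' : b != b' -> col b = col b' ->
  alternating [ffun a => G (tperm b b' a)] = - alternating G.
Proof.
move=> ne ec; rewrite !ffunE (reindex_inj (mulgI (tperm b b'))) /= -sumrN.
have colt a : col (tperm b b' a) = col a by case: tpermP => // ->.
apply: eq_big => [s|s _]; last
  by rewrite odd_permM odd_tperm ne signr_addb mulN1r.
congr andb.
  apply/col_permP/col_permP => h a; last by rewrite permM h colt.
  by have := h (tperm b b' a); rewrite permM tpermK colt.
apply/eqP/eqP => /ffunP h; apply/ffunP => a.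
  by have := h (tperm b b' a); rewrite !ffunE permM tpermK.
by rewrite ffunE h !ffunE permM.
Qed.

Lemma alternating_row : alternating [ffun b => r0 b] = 1.
Proof.
rewrite ffunE (bigD1 1%g) /=; last first.
  apply/andP; split; first by apply/col_permP => b; rewrite perm1.
  by apply/eqP/ffunP => b; rewrite !ffunE perm1.
rewrite odd_perm1 expr0 big1 ?addr0 // => s /andP[/andP[/col_permP hc
  /eqP/ffunP hr]].
case/eqP; apply/permP => b; rewrite perm1; apply: box_inj => //.
by have := hr b; rewrite !ffunE.
Qed.

Lemma alternating_support G : alternating G != 0 ->
  exists2 s, col_perm s & forall b, G b = r0 (s b).
Proof.
rewrite ffunE; have [/existsP[s /andP[hs /eqP/ffunP h]] _|/existsPn h] :=
  boolP [exists s, col_perm s && (G == [ffun b => r0 (s b)])].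
  by exists s => // b; rewrite h ffunE.
by rewrite big1 ?eqxx // => s hs; have := h s; rewrite hs.
Qed.

Lemma alternating_diag x : is_diag_mx x ->
  tact x alternating = (\sum_b x (r0 b) (r0 b)) *: alternating.
Proof.
move=> /is_diag_mxP hx; apply/ffunP => G; rewrite [RHS]ffunE [LHS]ffunE.
transitivity ((\sum_b x (G b) (G b)) * alternating G).
  rewrite mulr_suml; apply: eq_bigr => b _.
  rewrite (bigD1 (G b)) //= update_id big1 ?addr0 // => j nj.
  by rewrite hx ?mul0r // eq_sym.
have [->|/alternating_support[s _ hs]] := eqVneq (alternating G) 0.
  by rewrite mulr0 scaler0.
congr (_ * _); rewrite [RHS](reindex_inj (@perm_inj _ s)).
by apply: eq_bigr => b _; rewrite hs.
Qed.

Hypothesis r0_down : forall b (j : 'I_N), (j <= r0 b)%N ->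
  exists2 b', col b' = col b & r0 b' = j.

Lemma tact_swap x u G b b' :
    (forall G, u [ffun a => G (tperm b b' a)] = - u G) ->
  tact x u [ffun a => G (tperm b b' a)] = - tact x u G.
Proof.
move=> hu; rewrite !ffunE (reindex_inj (@perm_inj _ (tperm b b'))) /= -sumrN.
apply: eq_bigr => a _; rewrite -sumrN; apply: eq_bigr => j _.
rewrite ffunE tpermK -mulrN -hu; congr (_ * u _); apply/ffunP => a'.
by rewrite !ffunE; rewrite (canF_eq (tpermK b b')).
Qed.

(* If the operator of a strictly upper triangular matrix reaches [G] from the
   support of [alternating], then two boxes of a column of [G] have the same
   entry, and antisymmetry gives 0. *)
Lemma alternating_upper x : (forall i j, x i j != 0 -> (i < j)%N) ->
  tact x alternating = 0.
Proof.
move=> hx; apply/ffunP => G; rewrite [RHS]ffunE; apply/eqP;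
  apply: contraT => ne0.
have /existsP[b /existsP[j /andP[xj aj]]] :
    [exists b, exists j, (x (G b) j != 0) && (alternating (update G b j) != 0)].
  apply: contraNT ne0 => /existsPn h; rewrite ffunE big1 // => b _.
  rewrite big1 // => j _; have /existsPn/(_ j) := h b.
  by rewrite negb_and !negbK => /orP[]/eqP->; rewrite ?mul0r ?mulr0.
have lt := hx _ _ xj; have [s /col_permP hc hs] := alternating_support aj.
have ej : j = r0 (s b) by have := hs b; rewrite ffunE eqxx.
have [|b0 c0 e0] := @r0_down (s b) (G b); first by rewrite -ej ltnW.
pose b' := (s^-1)%g b0.
have sb' : s b' = b0 by rewrite permKV.
have nb : b != b'.
  by apply: contraTneq lt => e; rewrite ej -e0 -sb' e ltnn.
have eG : G b' = G b.
  by have := hs b'; rewrite ffunE eq_sym (negPf nb) sb' e0.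
have ec : col b = col b' by rewrite -hc -c0 -sb' hc.
have := @tact_swap x alternating G b b' (fun G => alternating_swap G nb ec).
have -> : [ffun a => G (tperm b b' a)] = G.
  by apply/ffunP => a; rewrite ffunE; case: tpermP => // ->.
move/eqP; rewrite -subr_eq0 opprK -mulr2n -mulr_natr mulf_eq0 pnatr_eq0 orbF.
by move=> h; rewrite h in ne0.
Qed.

End TensorPower.

(** * Leading monomials *)

Section Rearrangement.
Variables (B : finType) (N : nat) (col : B -> nat) (r0 : B -> 'I_N).
Hypothesis box_inj : forall b b', col b = col b' -> r0 b = r0 b' -> b = b'.

(* Conditions (i) and (ii) on tableaux. *)
Definition column_ordered (G : B -> 'I_N) :=
  (forall b, G b <> r0 b -> forall b', col b' = col b -> r0 b' < G b)%N /\
  (forall b b', col b = col b' -> (r0 b < r0 b')%N -> G b <> r0 b ->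
    (G b' < G b)%N).

Lemma column_ordered_ge G b : column_ordered G -> (r0 b <= G b)%N.
Proof.
by case=> h _; have [->//|/eqP/h hb] := eqVneq (G b) (r0 b); apply/ltnW/hb.
Qed.

(* Swapping the images of the lowest moved box [b0] of a column and of the box
   mapped to [b0] lowers the sum. *)
Lemma rearrangement G (s : {perm B}) : column_ordered G ->
    (forall b, col (s b) = col b) -> (forall b, r0 (s b) <= G b)%N ->
      s != 1%g ->
  (\sum_b G b * r0 b < \sum_b G b * r0 (s b))%N.
Proof.
move=> hG; have [h1 h2] := hG.
have [k] := ubnP #|[set b | s b != b]%SET|; elim: k s => // k IHk s hk hc hs s1.
have [b' hb'] : exists b, s b != b.
  apply/existsP; apply: contraNT s1 => /existsPn h.
  by apply/eqP/permP => b; rewrite perm1; apply/eqP/negPn/h.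
case: (@arg_maxnP _ b' (fun b => s b != b) (fun b => r0 b : nat) hb') => b0
  hb0 hmax.
pose b1 := (s^-1)%g b0; have sb1 : s b1 = b0 by rewrite permKV.
have nb : b1 != b0 by apply: contraNneq hb0 => e; rewrite -{2}sb1 e.
have lt_r0 b : s b != b -> col b = col b0 -> b != b0 -> (r0 b < r0 b0)%N.
  move=> hb cb nbb; rewrite ltn_neqAle; have := hmax b hb;
    rewrite /geq /= => ->; rewrite andbT.
  by apply: contra nbb => /eqP/val_inj e; apply/eqP/box_inj.
have lt1 : (r0 b1 < r0 b0)%N.
  by apply: lt_r0 => //; [rewrite sb1 eq_sym | rewrite -[in RHS]sb1 hc].
have lt0 : (r0 (s b0) < r0 b0)%N.
  by apply: lt_r0; rewrite ?hc ?(inj_eq perm_inj).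
have ltG : (G b0 < G b1)%N.
  apply: h2 => //; first by rewrite -sb1 hc.
  by move=> e; have := hs b1; rewrite sb1 e; lia.
pose s' := (tperm b0 b1 * s)%g.
have s'0 : s' b0 = b0 by rewrite permM tpermL.
have s'1 : s' b1 = s b0 by rewrite permM tpermR.
have s'E b : b != b0 -> b != b1 -> s' b = s b.
  by move=> n0 n1; rewrite permM tpermD // eq_sym.
have hc' b : col (s' b) = col b.
  have [->|n0] := eqVneq b b0; first by rewrite s'0.
  have [->|n1] := eqVneq b b1; first by rewrite s'1 hc -{1}sb1 hc.
  by rewrite s'E.
have hs' b : (r0 (s' b) <= G b)%N.
  have [->|n0] := eqVneq b b0; first by rewrite s'0 column_ordered_ge.
  have [->|n1] := eqVneq b b1; last by rewrite s'E.
  by rewrite s'1; have := column_ordered_ge b0 hG; lia.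
have step : (\sum_b G b * r0 (s' b) < \sum_b G b * r0 (s b))%N.
  rewrite (bigD1 b0) // (bigD1 b1) //= [ltnRHS](bigD1 b0) //= [X in (_ < _ +
    X)%N](bigD1 b1) //=.
  rewrite s'0 s'1 sb1 !addnA (eq_bigr (fun b => G b * r0 (s b))%N) ?ltn_add2r.
    by move: (nat_of_ord (G b0)) (nat_of_ord (G b1)) (nat_of_ord (r0 b0))
       (nat_of_ord (r0 (s b0))) lt0 ltG => g0 g1 x y; nia.
  by move=> b /andP[n0 n1]; rewrite s'E.
have [e|ne] := eqVneq s' 1%g.
  by move: step; under eq_bigr do rewrite e perm1.
apply: ltn_trans step; apply: IHk => //.
apply: leq_trans (proper_card _) (ltnSE hk); apply/properP; split.
  apply/fintype.subsetP => b; rewrite !finset.inE.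
  have [->|n0] := eqVneq b b0; first by rewrite s'0 eqxx.
  have [->|n1] := eqVneq b b1; last by rewrite s'E.
  by move=> _; rewrite sb1 eq_sym.
by exists b0; rewrite finset.inE // s'0 eqxx.
Qed.

Definition sqdist (G G' : B -> 'I_N) : nat := \sum_b (G b - G' b) ^ 2.

Lemma sqdistE (G G' : B -> 'I_N) : (forall b, G' b <= G b)%N ->
  (sqdist G G' + 2 * \sum_b G b * G' b = \sum_b G b ^ 2 + \sum_b G' b ^ 2)%N.
Proof.
move=> h; rewrite /sqdist big_distrr -!big_split; apply: eq_bigr => b _ /=.
by have := h b; move: (nat_of_ord (G b)) (nat_of_ord (G' b)) => x y; nia.
Qed.

(** When the squares are expanded, only the mixed term depends on [s], and by [rearrangement] it is
    smallest for the identity alone. *)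
Lemma sqdist_perm G (s : {perm B}) : column_ordered G ->
    (forall b, col (s b) = col b) -> (forall b, r0 (s b) <= G b)%N ->
  (sqdist G (r0 \o s) <= sqdist G r0 ?= iff (s == 1%g))%N.
Proof.
move=> hG hc hs; have e1 := @sqdistE G (r0 \o s) hs.
have e2 := @sqdistE G r0 (fun b => column_ordered_ge b hG).
have e3 : (\sum_b r0 b ^ 2 = \sum_b (r0 \o s) b ^ 2)%N.
  by rewrite (reindex_inj (@perm_inj _ s)).
have [es|ns] := eqVneq s 1%g.
  have -> : sqdist G (r0 \o s) = sqdist G r0.
    by apply: eq_bigr => b _; rewrite /= es perm1.
  exact/leqif_refl.
have /= h := rearrangement hG hc hs ns.
suff lt : (sqdist G (r0 \o s) < sqdist G r0)%N by split;
  [apply: ltnW | apply: ltn_eqF].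
by move: e1 e2 h; rewrite e3 /=; lia.
Qed.

End Rearrangement.

(** * Energy of a word and its leading coefficient *)

Section LeadingMonomial.
Variables (F : numClosedFieldType) (B : finType) (N : nat).
Variables (col : B -> nat) (r0 : B -> 'I_N).
Hypothesis box_inj : forall b b', col b = col b' -> r0 b = r0 b' -> b = b'.
Variables (I : finType) (f : I -> 'M[F]_N) (len : I -> nat).
(* [shift a j i]: the matrix unit sending basis vector [j] to basis vector [i]
   occurs in [f a]. *)
Variable shift : I -> 'I_N -> 'I_N -> bool.
Hypothesis f_shift : forall a i j, (f a i j != 0) = shift a j i.
Hypothesis shift_len : forall a i j, shift a j i ->
  (j < i)%N /\ (i - j)%N = len a.
Hypothesis shift_uniq : forall a a' i j, shift a j i -> shift a' j i -> a = a'.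

Notation assignment := {ffun B -> 'I_N}.
Notation ordered := (column_ordered col r0).
Notation alt := (alternating F col r0).

Definition word_act (w : seq I) := foldr (fun a u => tact (f a) u) alt w.

Definition energy (w : seq I) : nat := \sum_(a <- w) len a ^ 2.

Definition steps (G G' : B -> 'I_N) a : nat :=
  \sum_b ((G' b < G b)%N && shift a (G' b) (G b)).

(** The invariant of the induction on words: what is known when a nonzero sequence of moves leads
    from the assignment [r0 \o s] to [G]. In the equality case every displaced box has moved in a
    single step. *)
Definition reaches (w : seq I) (s : {perm B}) (G : assignment) :=
  [/\ forall b, col (s b) = col b, forall b, (r0 (s b) <= G b)%N,
      (energy w <= sqdist G (r0 \o s))%N &
      energy w = sqdist G (r0 \o s) ->
        forall a, count_mem a w = steps G (r0 \o s) a].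

(** If the box has already moved by [p] and now moves by [l > 0], then
    [(p + l) ^ 2 >= p ^ 2 + l ^ 2], with equality only for [p = 0]. *)
Lemma reaches_cons a w s (G : assignment) b j :
    f a (G b) j != 0 -> reaches w s (update G b j) ->
  reaches (a :: w) s G /\ (energy (a :: w) = sqdist G (r0 \o s) ->
    j = r0 (s b)).
Proof.
rewrite f_shift => sh [hc hs he hcnt]; have [lt len_a] := shift_len sh.
have hb : (r0 (s b) <= j)%N by have := hs b; rewrite ffunE eqxx.
pose rest := (\sum_(b' | b' != b) (G b' - r0 (s b')) ^ 2)%N.
have eG : sqdist G (r0 \o s) = ((G b - r0 (s b)) ^ 2 + rest)%N
  by rewrite /sqdist (bigD1 b).
have eG' : sqdist (update G b j) (r0 \o s) = ((j - r0 (s b)) ^ 2 + rest)%N.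
  rewrite /sqdist (bigD1 b) //= ffunE eqxx; congr addn.
  by apply: eq_bigr => b' nb; rewrite ffunE (negPf nb).
have eE : energy (a :: w) = (len a ^ 2 + energy w)%N
  by rewrite /energy big_cons.
rewrite eG' in he hcnt; rewrite /reaches eG eE.
have key : ((j - r0 (s b)) ^ 2 + len a ^ 2 <= (G b - r0 (s b)) ^ 2 ?= iff (j
  == r0 (s b)))%N.
  have -> : (G b - r0 (s b) = (j - r0 (s b)) + len a)%N by rewrite -len_a; lia.
  have -> : (j == r0 (s b)) = (j - r0 (s b) == 0)%N by rewrite -val_eqE /=; lia.
  have len_gt0 : (0 < len a)%N by rewrite -len_a subn_gt0.
  rewrite sqrnD; apply/leqifP; case: eqP => [->|/eqP];
    first by rewrite mul0n addn0.
  by rewrite -lt0n => p0; rewrite -[ltnLHS]addn0 ltn_add2l !muln_gt0 p0.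
have [key1 key2] := key; split=> [|e]; last first.
  by apply/eqP; rewrite -key2; apply/eqP; lia.
split=> // [b'||e a'].
- have := hs b'; rewrite ffunE; case: eqP => // -> h.
  exact: leq_trans hb (ltnW lt).
- by lia.
have ej : j = r0 (s b) by apply/eqP; rewrite -key2; apply/eqP; lia.
rewrite /= hcnt; last by lia.
rewrite /steps (bigD1 b) //= [in RHS](bigD1 b) //= ffunE eqxx -ej ltnn add0n
  lt /=.
congr addn; last by apply: eq_bigr => b' nb; rewrite ffunE (negPf nb).
by congr nat_of_bool; apply/eqP/idP => [<-//|sh']; apply: shift_uniq sh sh'.
Qed.

Lemma word_act_reaches w G : word_act w G != 0 -> exists s, reaches w s G.
Proof.
elim: w G => [|a w IHw] G /=.
  case/alternating_support => s /col_permP hs eG; exists s.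
  have e0 : sqdist G (r0 \o s) = 0%N by rewrite /sqdist big1 // => b _;
    rewrite eG subnn.
  split=> // [b||_ a]; rewrite ?eG ?e0 /energy ?big_nil //.
  by rewrite /steps big1 // => b _; rewrite eG /= ltnn.
move=> ne0; have /existsP[b /existsP[j /andP[xj aj]]] :
    [exists b, exists j, (f a (G b) j != 0) && (word_act w (update G b j) !=
      0)].
  apply: contraNT ne0 => /existsPn h; rewrite ffunE big1 // => b _.
  rewrite big1 // => j _; have /existsPn/(_ j) := h b.
  by rewrite negb_and !negbK => /orP[]/eqP->; rewrite ?mul0r ?mulr0.
have [s hs] := IHw _ aj; exists s.
by have [] := reaches_cons xj hs.
Qed.

Lemma energy_bound w (G : assignment) : ordered G -> word_act w G != 0 ->
  (energy w <= sqdist G r0)%N /\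
  (energy w = sqdist G r0 -> forall a, count_mem a w = steps G r0 a).
Proof.
move=> hG /word_act_reaches[s [hc hs he hcnt]].
have [le1 eq1] := sqdist_perm box_inj hG hc hs.
split=> [|e a]; first exact: leq_trans he le1.
have es : s = 1%g by apply/eqP; rewrite -eq1; apply/eqP; lia.
rewrite hcnt; last by lia.
by apply: eq_bigr => b _; rewrite /= es perm1.
Qed.

Definition covered (G : assignment) :=
  forall b, G b <> r0 b -> exists a, shift a (r0 b) (G b).

Lemma energy_steps w (G : assignment) : ordered G -> covered G ->
  (forall a, count_mem a w = steps G r0 a) -> energy w = sqdist G r0.
Proof.
move=> hG cov hcnt.
have -> : energy w = (\sum_a count_mem a w * len a ^ 2)%N.
  elim: w {hcnt} => [|a w IHw]; first by rewrite /energy big_nil big1.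
  rewrite /energy big_cons -/(energy w) IHw [in RHS](bigD1 a) //= eqxx.
  rewrite (bigD1 a) //= mulnDl mul1n -addnA; congr (_ + (_ + _))%N.
  by apply: eq_bigr => a' na; rewrite eq_sym (negPf na).
under eq_bigr do rewrite hcnt big_distrl.
rewrite exchange_big; apply: eq_bigr => b _ /=.
have [->|/eqP nb] := eqVneq (G b) (r0 b).
  by rewrite subnn big1 // => a _; rewrite ltnn.
have [a sh] := cov _ nb; have [lt ->] := shift_len sh.
rewrite (bigD1 a) //= lt sh mul1n big1 ?addn0 // => a' na.
case sh' : (shift a' _ _) => //.
by case/eqP: na; apply: shift_uniq sh' sh.
Qed.

(** For a covered [G] the inner sum has a single term, by [shift_uniq]; summing avoids choosing the
    root of each displaced box. *)
Definition leading_coef (G : assignment) : F :=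
  \prod_(b | (r0 b < G b)%N) \sum_(a | shift a (r0 b) (G b)) f a (G b) (r0 b).

Lemma leading_coef_neq0 (G : assignment) : ordered G -> covered G ->
  leading_coef G != 0.
Proof.
move=> hG cov; apply/prodf_neq0 => b lt.
have [|a sh] := cov b; first by move=> e; rewrite e ltnn in lt.
rewrite (bigD1 a) //= big1 ?addr0 ?f_shift // => a' /andP[sh' na].
by case/eqP: na; apply: shift_uniq sh' sh.
Qed.

Lemma update_ordered (G : assignment) b : ordered G ->
  ordered (update G b (r0 b)).
Proof.
move=> hG; have [h1 h2] := hG; split=> [b1|b1 b2 ec lt]; rewrite !ffunE.
  by case: eqP => [->//|_]; apply: h1.
case: eqP => [->//|_] hb1; case: eqP => [e|_]; last exact: h2.
by rewrite -e; apply: h1.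
Qed.

Lemma update_covered (G : assignment) b : covered G ->
  covered (update G b (r0 b)).
Proof. by move=> cov b'; rewrite ffunE; case: eqP => [->//|_]; apply: cov. Qed.

(* Only the removal of a full step [r0 b -> G b] contributes, since any other
   contribution would have too small an energy; all contributions then have the
   same coefficient, so that they cannot cancel. *)
Lemma word_act_leading w (G : assignment) : ordered G -> covered G ->
    (forall a, count_mem a w = steps G r0 a) ->
  exists2 k : nat, (0 < k)%N & word_act w G = k%:R * leading_coef G.
Proof.
elim: w G => [|a w IHw] G hG cov hcnt.
  have eG b : G b = r0 b.
    apply/eqP/negPn/negP => /eqP nb; have [a sh] := cov _ nb.
    have := hcnt a; rewrite /steps (bigD1 b) //= sh.
    by have [-> _] := shift_len sh.
  exists 1%N => //; rewrite mul1r /leading_coef big_pred0 => [|b];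
    last by rewrite eG ltnn.
  have -> : G = [ffun b => r0 b] by apply/ffunP => b; rewrite ffunE.
  exact: alternating_row.
pose E := [pred b | (r0 b < G b)%N && shift a (r0 b) (G b)].
have hE b : E b -> exists2 k : nat, (0 < k)%N &
    word_act w (update G b (r0 b)) * f a (G b) (r0 b) = k%:R * leading_coef G.
  case/andP=> lt sh.
  have [|k k0 ->] := IHw (update G b (r0 b)) (update_ordered _ hG)
    (update_covered cov).
    move=> a'; have := hcnt a'; rewrite /steps /= (bigD1 b) //= lt.
    have -> : shift a' (r0 b) (G b) = (a == a').
      by apply/idP/eqP => [/(shift_uniq sh)|<-].
    move/addnI->; rewrite [RHS](bigD1 b) //= ffunE eqxx ltnn add0n.
    by apply: eq_bigr => b' nb; rewrite ffunE (negPf nb).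
  exists k => //; rewrite -mulrA; congr (_ * _).
  rewrite /leading_coef [RHS](bigD1 b) //= mulrC; congr (_ * _).
    rewrite (bigD1 a) //= big1 ?addr0 // => a' /andP[sh' /eqP[]].
    exact: shift_uniq sh' sh.
  apply: eq_big => b'; rewrite ffunE; case: eqP => [->|_];
    rewrite ?ltnn ?andbF ?andbT //.
have /fin_all_exists[k hk] : forall b, exists k : nat, E b ->
    (0 < k)%N /\ word_act w (update G b (r0 b)) * f a (G b) (r0 b) = k%:R *
      leading_coef G.
  move=> b; case: (boolP (E b)) => [/hE[k k0 hk]|_]; last by exists 0%N.
  by exists k.
exists (\sum_(b | E b) k b)%N.
  have /existsP[b Eb] : [exists b, E b].
    apply: contraT => /existsPn h; have := hcnt a;
      rewrite /= eqxx /steps big1 // => b _.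
    by have := h b; rewrite /E /= => /negPf ->.
  by rewrite (bigD1 b) //= ltn_addr //; have [] := hk _ Eb.
rewrite natr_sum mulr_suml /= ffunE [RHS]big_mkcond; apply: eq_bigr => b _.
have van j : f a (G b) j * word_act w (update G b j) != 0 -> E b /\ j = r0 b.
  rewrite mulf_eq0 negb_or => /andP[fj wj].
  have [s rs] := word_act_reaches wj.
  have [[hc hs he _] hj] := reaches_cons fj rs.
  have [le1 eq1] := sqdist_perm box_inj hG hc hs.
  have e := energy_steps hG cov hcnt.
  have le2 := leq_trans le1 (eq_leq (esym e)).
  have es : s = 1%g.
    by apply/eqP; rewrite -eq1 eqn_leq le1;
      apply: leq_trans (eq_leq (esym e)) he.
  have ej : j = r0 b.
    by rewrite hj; [rewrite es perm1 | apply/eqP; rewrite eqn_leq he le2].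
  move: fj; rewrite f_shift ej => sh; split=> //.
  by rewrite /E /= sh; have [-> _] := shift_len sh.
have [Eb|nEb] := ifPn.
  have [_ <-] := hk _ Eb; rewrite (bigD1 (r0 b)) //= mulrC big1 ?addr0 // => j
    nj.
  by apply/eqP; apply: contraT => /van[_ e]; rewrite e eqxx in nj.
by rewrite big1 // => j _; apply/eqP; apply: contraT => /van[Eb _];
  case/negP: nEb.
Qed.

End LeadingMonomial.

(** * The Lie algebra *)

Section LieAlgebra.
Variables (F : numClosedFieldType) (tp : cartan_type) (n : nat).
Notation N := (natdim tp n).
Notation lie := (@lie_alg F tp n).
Notation cartan_sub := (@cartan F tp n).
Notation root := (posroot tp n).
Implicit Types (x y h : 'M[F]_N) (a : root).

Definition form_sign (i : nat) : F := if (i < n)%N then 1 else -1.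

Lemma lie_algP x : lie x <->
  (if is_C tp then forall i j, form_sign (rev_ord j) * x (rev_ord j) i
                             + form_sign i * x (rev_ord i) j = 0
   else \tr x = 0).
Proof.
rewrite /lie_alg /=; case: tp x => //= x.
have formE (i j : 'I_(n.*2)) : symp_form F n n.*2 i j =
    if i == rev_ord j then form_sign i else 0.
  rewrite mxE /form_sign; have ->
    // : ((i + j).+1 == n.*2)%N = (i == rev_ord j).
  by rewrite -val_eqE /=; have := ltn_ord i; have := ltn_ord j; lia.
have e i j : (x^T *m symp_form F n n.*2 + symp_form F n n.*2 *m x) i j =
    form_sign (rev_ord j) * x (rev_ord j) i + form_sign i * x (rev_ord i) j.
  rewrite !mxE (bigD1 (rev_ord j)) //= [in X in _ + X](bigD1 (rev_ord i)) //=.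
  rewrite !big1 ?addr0 => [|k nk|k nk].
  - by rewrite !formE mxE rev_ordK !eqxx mulrC.
  - rewrite formE ifN ?mul0r //; apply: contra nk => /eqP->.
    by rewrite rev_ordK.
  - by rewrite formE (negPf nk) mulr0.
split=> [h i j|h]; first by rewrite -e h mxE.
by apply/matrixP => i j; rewrite e h mxE.
Qed.

Lemma lie_linear c x y : lie x -> lie y -> lie (c *: x + y).
Proof.
rewrite !lie_algP; case: is_C => [hx hy i j|hx hy].
  rewrite !mxE !mulrDr addrACA hy addr0 mulrCA [X in _ + X]mulrCA -mulrDr.
  by rewrite hx mulr0.
by rewrite mxtraceD mxtraceZ hx hy mulr0 addr0.
Qed.

Lemma lie0 : lie 0.
Proof.
by rewrite lie_algP; case: is_C => [i j|];
  rewrite ?mxE ?mulr0 ?addr0 // mxtrace0.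
Qed.

Lemma lie_sum (I : Type) (r : seq I) (P : pred I) (E : I -> 'M[F]_N) :
  (forall i, P i -> lie (E i)) -> lie (\sum_(i <- r | P i) E i).
Proof.
move=> h; apply: big_ind => // [|x y hx hy]; first exact: lie0.
by rewrite -[x]scale1r; apply: lie_linear.
Qed.

Lemma lie_bracket x y : lie x -> lie y -> lie (bracket x y).
Proof.
rewrite /lie_alg /bracket /=; case: tp x y => /= x y hx hy.
  by rewrite linearB /= mxtrace_mulC subrr.
set J := symp_form _ _ _ in hx hy *.
have {}hx : x^T *m J = - (J *m x) by apply/eqP; rewrite -addr_eq0; apply/eqP.
have {}hy : y^T *m J = - (J *m y) by apply/eqP; rewrite -addr_eq0; apply/eqP.
rewrite linearB /= !trmx_mul mulmxBl mulmxBr -!mulmxA hx hy !mulmxN !mulmxA hx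
  hy.
by rewrite !mulNmx !opprK -!mulmxA addrC addrA subrK subrr.
Qed.

Lemma form_signK i : form_sign i * form_sign i = 1.
Proof. by rewrite /form_sign; case: ifP; rewrite ?mulrNN mulr1. Qed.

Lemma lie_adjoint x : lie x -> lie (adjoint x).
Proof.
rewrite !lie_algP; case: is_C => [hx i j|hx]; last first.
  have -> : \tr (adjoint x) = (\tr x)^*.
    by rewrite rmorph_sum; apply: eq_bigr => i _; rewrite mxE.
  by rewrite hx rmorph0.
have h := hx (rev_ord j) (rev_ord i); rewrite !rev_ordK in h.
have signC k : (form_sign k)^* = form_sign k.
  by rewrite /form_sign; case: ifP; rewrite ?rmorphN rmorph1.
rewrite !mxE -[form_sign (rev_ord j)]signC -[form_sign i]signC -!rmorphM
  -rmorphD.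
apply/eqP; rewrite conjC_eq0; apply/eqP.
move: (form_signK i) (form_signK (rev_ord j)) h.
move: (form_sign i) (form_sign (rev_ord j)) (x i _) (x j _) => si sj X Y hi hj
  h.
transitivity (si * sj * (si * X + sj * Y)); last by rewrite h mulr0.
by rewrite -[in LHS](mul1r (sj * X)) -[in LHS](mul1r (si * Y)) -{1}hi -hj; ring.
Qed.

Definition mask (D : rel 'I_N) x : 'M[F]_N :=
  \matrix_(i, j) if D i j then x i j else 0.

(** The symplectic condition ties the entry [(i, j)] to [(rev_ord j, rev_ord i)], hence the symmetry
    of the mask; constancy on the diagonal preserves trace zero. *)
Lemma lie_mask (D : rel 'I_N) d x :
    (is_C tp -> forall i j, D i j = D (rev_ord j) (rev_ord i)) ->
    (forall i, D i i = d) -> lie x -> lie (mask D x).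
Proof.
move=> hD hd; rewrite !lie_algP; case: is_C hD => [/(_ isT) hD hx i j|_ hx].
  rewrite !mxE (hD (rev_ord j)) rev_ordK; case: ifP => // _.
  by rewrite !mulr0 addr0.
rewrite /mxtrace; under eq_bigr do rewrite mxE hd.
by case: d {hd}; [apply: hx | apply: big1].
Qed.

Lemma eps_diag (i : 'I_N) h : eps i.+1 h = h i i.
Proof.
rewrite /eps (bigD1 i) //= big1 ?addr0 // => j /andP[/eqP[e] /eqP[]].
exact: val_inj.
Qed.

Lemma eps_bar k h : is_C tp -> cartan_sub h -> (0 < k <= N)%N ->
  eps (bar n k) h = - eps k h.
Proof.
move=> hC [/lie_algP]; rewrite hC => hl _ /andP[k0 kN].
have hk : (k.-1 < N)%N by rewrite prednK.
have := hl (Ordinal hk) (rev_ord (Ordinal hk));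
  rewrite rev_ordK -mulrDr => /eqP.
rewrite mulf_eq0 => /orP[/eqP s0|].
  by have := form_signK (Ordinal hk); rewrite s0 mulr0 => /eqP;
    rewrite eq_sym oner_eq0.
rewrite addrC addr_eq0 => /eqP e.
have {1}-> : bar n k = (rev_ord (Ordinal hk)).+1.
  by move: kN; rewrite /bar /= natdimE hC; lia.
by rewrite eps_diag e -eps_diag /= prednK.
Qed.

Lemma root_wt_linear c (r s : 'rV[int]_n) h :
  root_wt (r + c *: s) h = root_wt r h + c%:~R * root_wt (tp := tp) s h.
Proof.
rewrite /root_wt mulr_sumr -big_split; apply: eq_bigr => k _ /=.
by rewrite !mxE rmorphD rmorphM /= mulrDl mulrA.
Qed.

Lemma root_wtD (r s : 'rV[int]_n) h :
  root_wt (tp := tp) (r + s) h = root_wt r h + root_wt s h.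
Proof. by rewrite -[s]scale1r root_wt_linear mul1r scale1r. Qed.

Lemma root_wt0 h : root_wt (tp := tp) 0 h = 0.
Proof. by apply: big1 => k _; rewrite mxE mul0r. Qed.

Lemma root_wtN (r : 'rV[int]_n) h : root_wt (tp := tp) (- r) h = - root_wt r h.
Proof. by apply/eqP; rewrite -addr_eq0 -root_wtD addNr root_wt0. Qed.

Lemma root_wt_simple j h : (0 < j <= n)%N ->
  root_wt (simple n j) h = simple_wt (tp := tp) j h.
Proof.
case/andP=> j0 jn; have hj : (j.-1 < n)%N by rewrite prednK.
rewrite /root_wt (bigD1 (Ordinal hj)) //= big1 ?addr0 => [|k nk].
  by rewrite mxE /= prednK // eqxx mul1r.
rewrite mxE; case: eqP => [e|_]; last by rewrite mul0r.
by case/eqP: nk; apply: val_inj; rewrite /= -e.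
Qed.

Lemma simple_wt_fold k h : cartan_sub h -> (0 < k < N)%N ->
  simple_wt (tp := tp) (fold_index tp n k) h = eps k h - eps k.+1 h.
Proof.
move=> hh /andP[k0 kN]; rewrite /simple_wt /fold_index.
have [C|nC] := boolP (is_C tp); last by [].
rewrite /=; have kN' := kN; rewrite natdimE C in kN'.
have flip l : (0 < l <= N)%N -> eps (n.*2.+1 - l)%N h = - eps l h
  by apply: eps_bar.
case: (ltngtP k n) => [lt|gt|ek].
- by rewrite ltn_eqF.
- have -> : (n.*2 - k == n)%N = false by lia.
  have -> : (n.*2 - k)%N = (n.*2.+1 - k.+1)%N by [].
  rewrite flip; last by lia.
  have -> : ((n.*2.+1 - k.+1).+1 = n.*2.+1 - k)%N by lia.
  by rewrite flip ?opprK 1?addrC //; lia.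
subst k; rewrite eqxx mulr2n; congr (_ + _).
have -> : (n.+1 = n.*2.+1 - n)%N by lia.
by rewrite flip ?opprK // k0 ltnW.
Qed.

Lemma root_wt_eps i j h : cartan_sub h -> (0 < i <= j)%N -> (j <= N)%N ->
  root_wt (eps_root tp n i j) h = eps i h - eps j h.
Proof.
move=> hh /andP[i0 ij] jN.
have -> : eps i h - eps j h = \sum_(i <= k < j) (eps k h - eps k.+1 h).
  rewrite -[LHS]opprB -(telescope_sumr (fun k => eps k h)) // -sumrN.
  by apply: eq_bigr => k _; rewrite opprB.
rewrite /eps_root (big_morph (fun r => root_wt (tp :=
  tp) r h) (fun r s => root_wtD r s h) (root_wt0 h)).
rewrite big_nat [RHS]big_nat; apply: eq_bigr => k hk.
rewrite root_wt_simple; last exact: fold_index_ltn i0 jN _ hk.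
by apply: simple_wt_fold => //; lia.
Qed.

(* A multiple of the [l]-th fundamental coweight. *)
Definition coweight (l : 'I_n) : 'M[F]_N :=
  diag_mx (\row_i (if is_C tp then (i <= l)%:R - (n.*2 - l.+1 <= i)%:R
                   else (n.+1 * (i <= l))%:R - l.+1%:R)).

(** The 2 comes from the long simple root [2 epsilon_n]; the factor [n + 1] in type A clears the
    denominators of the trace-zero correction. *)
Definition coweight_scale (l : 'I_n) : nat :=
  if is_C tp then (if l.+1 == n then 2 else 1)%N else n.+1.

Lemma coweight_cartan l : cartan_sub (coweight l).
Proof.
split; last exact: diag_mx_is_diag.
rewrite lie_algP; have ln := ltn_ord l.
have [C|nC] := boolP (is_C tp).
  move=> i j; rewrite !mxE C.
  have [<-|nij] := eqVneq (rev_ord i) j; last first.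
    have -> : (rev_ord j == i) = false.
      by apply: contraNF nij => /eqP <-; rewrite rev_ordK.
    by rewrite !mulr0n !mulr0 addr0.
  have NE : N = n.*2 by rewrite natdimE C.
  rewrite rev_ordK eqxx !mulr1n -mulrDr.
  have -> : (rev_ord i <= l)%N = (n.*2 - l.+1 <= i)%N.
    by have := ltn_ord i; rewrite /=; lia.
  have -> : (n.*2 - l.+1 <= rev_ord i)%N = (i <= l)%N.
    by have := ltn_ord i; rewrite /=; lia.
  by rewrite -[X in _ * (_ + X)]opprB subrr mulr0.
rewrite mxtrace_diag; under eq_bigr do rewrite mxE (negPf nC).
rewrite big_split /= -natr_sum -big_distrr /= sumr_const card_ord natdimE
  (negPf nC).
under eq_bigr do rewrite -ltnS; rewrite sum_ord_ltn; last by lia.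
by rewrite mulNrn -mulrnA mulnC subrr.
Qed.

Lemma eps_coweight k l : (0 < k <= N)%N -> eps k (coweight l) =
  if is_C tp then (k.-1 <= l)%:R - (n.*2 - l.+1 <= k.-1)%:R
  else (n.+1 * (k.-1 <= l))%:R - l.+1%:R.
Proof.
case/andP=> k0 kN; have hk : (k.-1 < N)%N by rewrite prednK.
by rewrite -{1}(prednK k0) -[k.-1]/(val (Ordinal hk)) eps_diag !mxE eqxx mulr1n.
Qed.

Lemma simple_wt_coweight (k l : 'I_n) :
  simple_wt (tp := tp) k.+1 (coweight l) = ((k == l) * coweight_scale l)%:R :>
    F.
Proof.
have ln := ltn_ord l; have kn := ltn_ord k; have nN := leq_natdim tp n.
have hk : (0 < k.+1 <= N)%N by lia.
rewrite /simple_wt /coweight_scale; case: ifP => [/andP[C /eqP kE]|h].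
  rewrite eps_coweight ?C; last by lia.
  have -> : (n.*2 - l.+1 <= n.-1)%N = false by lia.
  have -> : (n.-1 <= l)%N = (l.+1 == n) by lia.
  have -> : (k == l) = (l.+1 == n) by rewrite -val_eqE /=; lia.
  by rewrite subr0; case: eqP => _; rewrite ?mul0rn.
have hk1 : (0 < k.+2 <= N)%N.
  by move: h; rewrite natdimE; case: (is_C tp) => /=; lia.
rewrite !eps_coweight // -val_eqE /=; case: (is_C tp) h => /= h.
  have -> : (n.*2 - l.+1 <= k)%N = false by lia.
  have -> : (n.*2 - l.+1 <= k.+1)%N = false by lia.
  rewrite !subr0; case: (ltngtP k l) => [lt|gt|e].
  - by rewrite subrr mul0n.
  - by rewrite subrr mul0n.
  - by rewrite subr0 -e h mul1n.
rewrite opprB addrA subrK.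
by case: (ltngtP k l) => _; rewrite ?muln1 ?muln0 ?mul0n ?mul1n ?subrr ?subr0.
Qed.

Lemma coweight_scale_gt0 l : (0 < coweight_scale l)%N.
Proof. by rewrite /coweight_scale; case: is_C => //; case: ifP. Qed.

Lemma root_wt_coweight (r : 'rV[int]_n) l :
  root_wt (tp := tp) r (coweight l) = (r 0 l)%:~R * (coweight_scale l)%:R.
Proof.
rewrite /root_wt (bigD1 l) //= simple_wt_coweight eqxx mul1n big1 ?addr0 // =>
  k nk.
by rewrite simple_wt_coweight (negPf nk) mul0n mulr0.
Qed.

Lemma root_wt_inj (r s : 'rV[int]_n) :
  (forall h, cartan_sub h -> root_wt (tp := tp) r h = root_wt s h) -> r = s.
Proof.
move=> e; apply/rowP => l; have := e _ (coweight_cartan l).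
rewrite !root_wt_coweight => /mulIf h; apply: (@intr_inj F); apply: h.
by rewrite pnatr_eq0 -lt0n coweight_scale_gt0.
Qed.

Lemma cartan_sum (I : Type) (r : seq I) (E : I -> 'M[F]_N) :
  (forall i, cartan_sub (E i)) -> cartan_sub (\sum_(i <- r) E i).
Proof.
move=> h; split; first by apply: lie_sum => i _; have [] := h i.
apply/is_diag_mxP => i j nij; rewrite summxE big1 // => k _.
by have [_ /is_diag_mxP] := h k; apply.
Qed.

Lemma root_wt_sumr (r : 'rV[int]_n) (I : Type) (s : seq I) (E : I -> 'M[F]_N) :
  root_wt (tp := tp) r (\sum_(i <- s) E i) = \sum_(i <- s) root_wt r (E i).
Proof.
have epsD k x y : eps k (x + y) = eps k x + eps k y :> F.
  by rewrite /eps -big_split; apply: eq_bigr => i _; rewrite mxE.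
have eps0 k : eps k (0 : 'M[F]_N) = 0 by apply: big1 => i _; rewrite mxE.
apply: (big_morph (fun h => root_wt (tp := tp) r h)) => [x y|].
  rewrite /root_wt -big_split; apply: eq_bigr => k _;
    rewrite /= -mulrDr /simple_wt.
  by congr (_ * _); case: ifP => _; rewrite !epsD ?mulrnDl // opprD addrACA.
rewrite /root_wt big1 // => k _; rewrite /simple_wt.
by case: ifP => _; rewrite !eps0 ?mul0rn ?subrr mulr0.
Qed.

(** Positive roots take positive integer values on it, so its eigenvalues separate [v] from
    everything obtained by lowering. *)
Definition height_element : 'M[F]_N := \sum_l coweight l.

Lemma height_element_cartan : cartan_sub height_element.
Proof. by apply: cartan_sum => l; apply: coweight_cartan. Qed.

Lemma root_wt_height (a : root) : exists2 d : nat, (0 < d)%N &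
  root_wt (val a) height_element = d%:R.
Proof.
rewrite root_wt_sumr; pose c (l : 'I_n) :=
  (absz (val a ord0 l) * coweight_scale l)%N.
have cE l : root_wt (val a) (coweight l) = (c l)%:R.
  rewrite root_wt_coweight /c natrM; congr (_ * _).
  by have := root_ge0 a l; case: (val a 0 l) => // k _.
exists (\sum_l c l)%N; last by rewrite natr_sum; apply: eq_bigr => l _;
  apply: cE.
have hr := row_lt a; have hc := root_canonical a.
have /and4P[r0 _ _ _] := canonical_pair_le hc.
rewrite (bigD1 (Ordinal hr)) //= ltn_addr // /c muln_gt0 coweight_scale_gt0
  andbT absz_gt0.
by rewrite rootE (eps_root_first_neq0 hc) //= prednK.
Qed.

Lemma bracket_diag h x i j : is_diag_mx h ->
  bracket h x i j = (h i i - h j j) * x i j.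
Proof.
move=> /is_diag_mxP hd; rewrite !mxE (bigD1 i) //= [in X in _ - X](bigD1 j) //=.
rewrite !big1 ?addr0 => [|k nk|k nk].
- by rewrite mulrBl [x i j * _]mulrC.
- by rewrite hd ?mulr0 // eq_sym.
- by rewrite hd ?mul0r // eq_sym.
Qed.

(* The positive root whose negative root space contains the matrix unit
   [(i, j)], [j < i]. *)
Definition lowers (a : root) (j i : 'I_N) : bool :=
  (j < i)%N && (val a == eps_root tp n j.+1 i.+1).

Lemma root_wt_entry (i j : 'I_N) h : cartan_sub h -> (j <= i)%N ->
  root_wt (eps_root tp n j.+1 i.+1) h = h j j - h i i.
Proof. by move=> hh ji; rewrite root_wt_eps // !eps_diag. Qed.

Lemma root_coord_gt0 (a : root) : exists l, 0 < val a 0 l.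
Proof.
have hr := row_lt a; have hc := root_canonical a.
have /and4P[r0 _ _ _] := canonical_pair_le hc.
exists (Ordinal hr); rewrite lt_def root_ge0 andbT.
by rewrite rootE (eps_root_first_neq0 hc) //= prednK.
Qed.

(** A nonzero entry [(i, j)] forces the positive root to be [h j j - h i i] on the Cartan
    subalgebra. For [i <= j] this is minus a sum of simple roots (possibly empty), which is not
    positive. *)
Lemma root_space_lower (a : root) x i j :
  root_space (- val a) x -> x i j != 0 -> lowers a j i.
Proof.
move=> [_ hx] nz.
have wt h : cartan_sub h -> root_wt (val a) h = h j j - h i i.
  move=> hh; have [_ hd] := hh; have /matrixP/(_ i j) := hx h hh.
  by rewrite bracket_diag // mxE root_wtN => /(mulIf nz) e;
    rewrite -[LHS]opprK -e opprB.
have [l al] := root_coord_gt0 a; rewrite /lowers.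
have [lt|ge] := ltnP j i.
  by apply/eqP/root_wt_inj => h hh; rewrite wt // root_wt_entry // ltnW.
have e : val a = - eps_root tp n i.+1 j.+1.
  by apply: root_wt_inj => h hh; rewrite wt // root_wtN root_wt_entry // opprB.
by move: al; rewrite e mxE eps_rootE oppr_gt0.
Qed.

Lemma rev_bar (i : 'I_N) : is_C tp -> (rev_ord i).+1 = bar n i.+1.
Proof. by move=> C; have := natdimE tp n; have := ltn_ord i;
  rewrite C /bar /=; lia. Qed.

Lemma lowers_rev (a : root) i j : is_C tp ->
  lowers a (rev_ord i) (rev_ord j) = lowers a j i.
Proof.
move=> C; rewrite /lowers; have := ltn_ord i; have := ltn_ord j => hi hj.
have -> : (rev_ord i < rev_ord j)%N = (j < i)%N by rewrite /=; lia.
case: ltnP => //= ji; rewrite !rev_bar // eps_root_flip //.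
by have := natdimE tp n; rewrite C; lia.
Qed.

Lemma lowers_exists (i j : 'I_N) : (j < i)%N -> exists a : root, lowers a j i.
Proof.
move=> ji; have hr : eps_root tp n j.+1 i.+1 \in pos_roots tp n.
  by apply: eps_root_pos => //; rewrite ltnS ji ltn_ord.
by exists (SeqSub hr); rewrite /lowers ji /=.
Qed.

Lemma lowers_uniq (a a' : root) i j : lowers a j i -> lowers a' j i -> a = a'.
Proof. by move=> /andP[_ /eqP e] /andP[_ /eqP e']; apply: val_inj;
  rewrite e e'. Qed.

(** A pair or its flip is canonical, and a root has only one canonical pair. *)
Lemma lowers_eq (a : root) (i j i' j' : 'I_N) : lowers a j i ->
  lowers a j' i' ->
  (j = j' /\ i = i') \/ [/\ is_C tp, j' = rev_ord i & i' = rev_ord j].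
Proof.
have canon (k l : 'I_N) : (k < l)%N -> canonical_pair tp n k.+1 l.+1 \/
    is_C tp /\ canonical_pair tp n (rev_ord l).+1 (rev_ord k).+1.
  move=> kl; have [//||h|[C h]] := @canonical_pair_flip tp n k.+1 l.+1.
  - by rewrite ltnS kl ltn_ord.
  - by left.
  - by right; rewrite !rev_bar.
have eqc (k l k' l' : 'I_N) : canonical_pair tp n k.+1 l.+1 ->
    canonical_pair tp n k'.+1 l'.+1 -> lowers a k l -> lowers a k' l' ->
      k = k' /\ l = l'.
  move=> c c' /andP[_ /eqP e] /andP[_ /eqP e'].
  have [[ek] [el]] := eps_root_inj c c' (etrans (esym e) e').
  by split; apply: val_inj.
move=> h h'; have /andP[lt _] := h; have /andP[lt' _] := h'.
have [c|[C c]] := canon _ _ lt; have [c'|[C' c']] := canon _ _ lt'.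
- by left; apply: eqc.
- have hr : lowers a (rev_ord i') (rev_ord j') by rewrite lowers_rev.
  by have [-> ->] := eqc _ _ _ _ c c' h hr; right; rewrite !rev_ordK.
- have hr : lowers a (rev_ord i) (rev_ord j) by rewrite lowers_rev.
  by have [<- <-] := eqc _ _ _ _ c c' hr h'; right.
have hr : lowers a (rev_ord i) (rev_ord j) by rewrite lowers_rev.
have hr' : lowers a (rev_ord i') (rev_ord j') by rewrite lowers_rev.
by have [/rev_ord_inj-> /rev_ord_inj->] := eqc _ _ _ _ c c' hr hr'; left.
Qed.

(** When a root owns two matrix units, the symplectic condition makes their coefficients equal up to
    sign, so both occur as soon as one does. *)
Lemma root_vector_entry (a : root) x i j : root_space (- val a) x -> x <> 0 ->
  (x i j != 0) = lowers a j i.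
Proof.
move=> hx nz; apply/idP/idP => [|la]; first exact: root_space_lower.
have [i0 [j0 nz0]] : exists i0 j0, x i0 j0 != 0.
  have /existsP[i0 /existsP[j0 h]] : [exists i0, exists j0, x i0 j0 != 0].
    apply: contraT => /existsPn h; case: nz; apply/matrixP => k l.
    by have /existsPn/(_ l) := h k; rewrite negbK mxE => /eqP.
  by exists i0, j0.
have [[<- <-]//|[C -> ->]] := lowers_eq (root_space_lower hx nz0) la.
have [/lie_algP + _] := hx; rewrite C => /(_ j0 (rev_ord i0)).
rewrite rev_ordK => h; apply: contra nz0 => /eqP e.
move: h; rewrite e mulr0 addr0 => /eqP; rewrite mulf_eq0 => /orP[/eqP s0|//].
by have := form_signK i0; rewrite s0 mulr0 => /eqP; rewrite eq_sym oner_eq0.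
Qed.

Definition lower_part (a : root) x := mask (fun i j => lowers a j i) x.
Definition upper_part (a : root) x := mask (lowers a) x.
Definition diag_part x := mask (fun i j => i == j) x.

Lemma lower_part_root a x : lie x -> root_space (- val a) (lower_part a x).
Proof.
move=> hx; split.
  apply: (lie_mask (d := false)) hx => [C i j|i]; first by rewrite lowers_rev.
  by rewrite /lowers ltnn.
move=> h hh; have [_ hd] := hh; apply/matrixP => i j.
rewrite bracket_diag // !mxE; case: ifP => [/andP[lt /eqP e]|_];
  last by rewrite !mulr0.
by rewrite root_wtN e root_wt_entry ?opprB // ltnW.
Qed.

Lemma upper_part_root a x : lie x -> root_space (val a) (upper_part a x).
Proof.
move=> hx; split.
  apply: (lie_mask (d := false)) hx => [C i j|i]; first by rewrite lowers_rev.
  by rewrite /lowers ltnn.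
move=> h hh; have [_ hd] := hh; apply/matrixP => i j.
rewrite bracket_diag // !mxE; case: ifP => [/andP[lt /eqP e]|_];
  last by rewrite !mulr0.
by rewrite e root_wt_entry // ltnW.
Qed.

Lemma diag_part_cartan x : lie x -> cartan_sub (diag_part x).
Proof.
move=> hx; split; last by apply/is_diag_mxP => i j /negPf h;
  rewrite mxE -val_eqE h.
apply: (lie_mask (d := true)) hx => [C i j|i]; last exact: eqxx.
by rewrite (inj_eq rev_ord_inj) eq_sym.
Qed.

Lemma upper_part_upper a x i j : upper_part a x i j != 0 -> (i < j)%N.
Proof. by rewrite mxE; case: ifP => [/andP[]//|]; rewrite eqxx. Qed.

Lemma triangular_decomposition x :
  x = diag_part x + \sum_a lower_part a x + \sum_a upper_part a x.
Proof.
apply/matrixP => i j; rewrite !mxE !summxE.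
have lowE a : lower_part a x i j = if lowers a j i then x i j else 0
  by rewrite mxE.
have upE a : upper_part a x i j = if lowers a i j then x i j else 0
  by rewrite mxE.
under eq_bigr do rewrite lowE; under [X in _ + X]eq_bigr do rewrite upE.
have sum0 (k l : 'I_N) : (k <= l)%N ->
  \sum_a (if lowers a l k then x i j else 0) = 0 :> F.
  by move=> kl; rewrite big1 // => a _; rewrite /lowers ltnNge kl.
have sum1 (k l : 'I_N) : (l < k)%N ->
  \sum_a (if lowers a l k then x i j else 0) = x i j :> F.
  move=> lk; have [a ha] := lowers_exists lk.
  rewrite (bigD1 a) //= ha big1 ?addr0 // => a' na; case: ifP => // ha'.
  by case/eqP: na; apply: lowers_uniq ha' ha.
case: (ltngtP i j) => [lt|gt|/val_inj e].
- by rewrite sum0 ?sum1 ?ltn_eqF // -?val_eqE ?ltn_eqF ?addr0 ?add0r // ltnW.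
- by rewrite sum1 // sum0 ?(ltnW gt) // -val_eqE gtn_eqF // add0r addr0.
- by rewrite !sum0 ?e // eqxx !addr0.
Qed.

End LieAlgebra.

(** * Transfer to the tensor power *)

Section Transfer.
Variables (F : numClosedFieldType) (tp : cartan_type) (n : nat).
Variables (V : vectType F) (rho : 'M[F]_(natdim tp n) -> 'End(V)).
Variables (m : 'I_n -> nat) (v : V).
Hypothesis rhoP : lie_module rho.
Hypothesis hv : highest_weight_vector m rho v.
Notation N := (natdim tp n).
Notation lie := (@lie_alg F tp n).
Notation root := (posroot tp n).
Notation tensor := {ffun {ffun box m -> 'I_N} -> F^o}.
Notation first_row := (row_tableau tp m).
Notation alt := (alternating F (@bcol n m) first_row).

Lemma first_row_inj (b b' : box m) :
  bcol b = bcol b' -> first_row b = first_row b' -> b = b'.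
Proof.
move=> ec /(congr1 val); rewrite !ffunE /= => er.
by apply: box_inj => //; rewrite /brow er.
Qed.

Lemma first_row_down (b : box m) (j : 'I_N) : (j <= first_row b)%N ->
  exists2 b', bcol b' = bcol b & first_row b' = j.
Proof.
rewrite ffunE /= => jb; have /andP[c0 _] := bcol_le b.
have [|b' [b1 b2]] := @col_box n m j.+1 (bcol b) c0.
  by apply: leq_trans (brow_col b).
exists b' => //; apply: val_inj; rewrite ffunE /=.
by case: b1.
Qed.

Lemma sum_row (W : nmodType) (E : nat -> W) :
  \sum_(b : box m) E (brow b) = \sum_(i < n) E i.+1 *+ part m i.+1.
Proof.
rewrite (partition_big (fun b : box m => (val b).1) predT) //=.
apply: eq_bigr => i _.
under eq_bigr => b /eqP e do rewrite /brow e.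
rewrite sumr_const; congr (_ *+ _).
have e : part m i.+1 = #|[pred c : 'I_(part m 1) | (c < part m i.+1)%N]|.
  by rewrite card_ord_ltn // part_anti.
rewrite e -(card_in_imset (f := fun b : box m => (val b).2)).
  apply: eq_card => c; rewrite inE; apply/imsetP/idP => [[b]|ci].
    by rewrite unfold_in => /eqP ei ->; have := brow_part b; rewrite /brow ei.
  have [|b [b1 b2]] := @box_exists n m i.+1 c.+1 isT; first by rewrite ci.
  exists b; last by apply: val_inj; case: b2.
  by rewrite unfold_in; apply/eqnP; case: b1.
move=> b b'; rewrite !unfold_in => /eqP h /eqP h' eb; apply: box_inj.
  by rewrite /brow h h'.
by rewrite /bcol eb.
Qed.

(** [epsilon_k] occurs in the fundamental weights of index at least [k], hence [lambda_k] times in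
    [lambda], and row [k] has [lambda_k] boxes. *)
Lemma hwtE (h : 'M[F]_N) : hwt m h = \sum_(b : box m) h (first_row b)
  (first_row b).
Proof.
have -> : \sum_(b : box m) h (first_row b) (first_row b) = \sum_(b : box m)
  eps (brow b) h.
  by apply: eq_bigr => b _; rewrite -eps_diag -[_.+1]/(entry _ b)
    entry_row_tableau.
rewrite (sum_row (fun k => eps k h)) /hwt /part.
under [RHS]eq_bigr do rewrite -sumrMnr.
rewrite (exchange_big_dep predT) //=; apply: eq_bigr => k _.
rewrite sumrMnl; congr (_ *+ _); rewrite /fund_wt big_add1 /= big_mkord.
have := big_ord_widen n (fun i => eps i.+1 h) (ltn_ord k).
by move=> ->; apply: eq_bigl => i; rewrite ltnS.
Qed.

(* The graph of the would-be isomorphism from the module generated by [v] to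
   the one generated by [alt]. *)
Inductive linked : V -> tensor -> Prop :=
| linked_vac : linked v alt
| linked_lin c a b a' b' : linked a b -> linked a' b' ->
    linked (c *: a + a') (c *: b + b')
| linked_low r y a b : root_space (- val (r : root)) y -> linked a b ->
    linked (rho y a) (tact y b).

Lemma linked0 : linked 0 0.
Proof.
have := linked_lin (-1) linked_vac linked_vac.
by rewrite !scaleN1r !addNr.
Qed.

Lemma linkedZ c a b : linked a b -> linked (c *: a) (c *: b).
Proof. by move=> h; have := linked_lin c h linked0; rewrite !addr0. Qed.

Lemma rho_linear c x y : lie x -> lie y ->
  rho (c *: x + y) = c *: rho x + rho y.
Proof. by case: rhoP => h _; apply: h. Qed.

Lemma rho0 : rho 0 = 0.
Proof.
have := rho_linear (-1) (lie0 F tp n) (lie0 F tp n).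
by rewrite scaler0 addr0 scaleN1r addNr.
Qed.

Lemma rho_bracket x y u : lie x -> lie y ->
  rho (bracket x y) u = rho x (rho y u) - rho y (rho x u).
Proof. by case: rhoP => _ h hx hy; apply: h. Qed.

(** In the triangular decomposition, the diagonal part acts by the same scalar on both vectors, the
    raising part kills both, and the lowering part is covered by a constructor. *)
Lemma linked_vac_act x : lie x -> linked (rho x v) (tact x alt).
Proof.
move=> hx; pose P y := lie y /\ linked (rho y v) (tact y alt).
have P_lin c y z : P y -> P z -> P (c *: y + z).
  move=> [hy ky] [hz kz]; split; first exact: lie_linear.
  rewrite rho_linear // tact_linearl add_lfunE scale_lfunE.
  exact: linked_lin.
have P0 : P 0.
  have P0' : linked (rho 0 v) (tact 0 alt).
    have -> : tact 0 alt = 0.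
      by have := tact_linearl (-1) 0 0 alt;
        rewrite scaler0 addr0 scaleN1r addNr.
    by rewrite rho0 lfunE; apply: linked0.
  by split; [apply: lie0|].
have P_sum (E : root -> 'M[F]_N) : (forall r, P (E r)) -> P (\sum_r E r).
  move=> h; apply: big_ind => // y z hy hz.
  by rewrite -[y]scale1r; apply: P_lin.
have [_ vup vwt] := hv.
have PD y z : P y -> P z -> P (y + z).
  by move=> hy hz; have := P_lin 1 y z hy hz; rewrite scale1r.
suff [] : P x by [].
rewrite [x]triangular_decomposition; apply: (PD); first apply: (PD);
  try apply: (P_sum) => r.
- have hd := diag_part_cartan hx; have [hl hdiag] := hd; split=> //.
  rewrite vwt // alternating_diag // hwtE.
  exact/linkedZ/linked_vac.
- have hr := lower_part_root r hx; have [hl _] := hr; split=> //.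
  exact: linked_low hr linked_vac.
have hr := upper_part_root r hx; have [hl _] := hr; split=> //.
rewrite (vup (val r)) //; last exact: valP.
rewrite (alternating_upper first_row_down); first exact: linked0.
by move=> i j; apply: upper_part_upper.
Qed.

(** Only lowering operators are built into [linked]. An arbitrary [x] is moved past them by [x y =
    [x, y] + y x], so the induction must let [x] vary. *)
Lemma linked_act x a b : lie x -> linked a b -> linked (rho x a) (tact x b).
Proof.
move=> hx hab; elim: hab x hx => {a b} [|c a b a' b' _ IH _ IH'|r y a b hy hab
  IH] x hx.
- exact: linked_vac_act.
- rewrite linearP tact_linear; exact: linked_lin (IH _ hx) (IH' _ hx).
have [hyl _] := hy.
have hb := IH _ (lie_bracket hx hyl).
rewrite rho_bracket // tact_bracket in hb.
have := linked_lin 1 hb (linked_low hy (IH _ hx)).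
by rewrite !scale1r !subrK.
Qed.

Notation hgt := (height_element F tp n).
Let vac_wt : F := hwt m hgt.

(* [u] is a sum of eigenvectors of [rho hgt] for eigenvalues [vac_wt - d],
   [0 < d]. *)
Definition kill (ds : seq nat) (u : V) : V :=
  foldr (fun d u => rho hgt u - (vac_wt - d%:R) *: u) u ds.

Definition below (u : V) := exists2 ds, all (fun d => 0 < d)%N ds & kill ds u
  = 0.

Lemma kill_linear ds c u u' : kill ds (c *: u + u') = c *: kill ds u + kill ds
  u'.
Proof.
elim: ds => //= d ds ->; rewrite linearP !scalerDr !scalerN opprD.
by rewrite !scalerA [_ * c]mulrC addrACA.
Qed.

Lemma kill_comm d ds u :
  kill ds (rho hgt u - (vac_wt - d%:R) *: u) =
  rho hgt (kill ds u) - (vac_wt - d%:R) *: kill ds u.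
Proof.
elim: ds => //= d' ds ->; set X := kill ds u; set H := rho hgt.
have E (c c' : F) : H (H X - c *: X) - c' *: (H X - c *: X) =
    H (H X) - (c + c') *: H X + (c * c') *: X.
  rewrite linearB linearZ /= scalerBr scalerA scalerDl [c' * c]mulrC opprB
    opprD.
  by rewrite !addrA [in LHS]addrAC.
by rewrite !E; congr (_ - _ *: _ + _ *: _); [apply: addrC | apply: mulrC].
Qed.

Lemma kill_cat ds ds' u : kill ds u = 0 -> kill (ds ++ ds') u = 0.
Proof.
move=> h; elim: ds' ds h => [|d ds' IH] ds h; first by rewrite cats0.
rewrite -cat_rcons; apply: IH; rewrite -cats1 /kill foldr_cat /= -/(kill ds _).
by rewrite kill_comm h linear0 scaler0 subrr.
Qed.

Lemma kill0 ds : kill ds 0 = 0.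
Proof. by elim: ds => //= d ds ->; rewrite linear0 scaler0 subrr. Qed.

Lemma below_linear c u u' : below u -> below u' -> below (c *: u + u').
Proof.
move=> [ds h1 h2] [ds' h1' h2']; exists (ds ++ ds');
  first by rewrite all_cat h1.
rewrite kill_linear kill_cat // /kill foldr_cat -!/(kill _ _) h2' kill0.
by rewrite scaler0 addr0.
Qed.

(** The operator lowers eigenvalues of the height element by [e > 0]: a factor for [d] becomes one
    for [e + d], and [v] itself lands in the eigenvalue for [e]. *)
Lemma below_low r y u : root_space (- val (r : root)) y ->
  below u \/ u = v -> below (rho y u).
Proof.
move=> hy hu; have [hyl hyw] := hy; have [e e0 he] := root_wt_height F r.
have [hl hd] := height_element_cartan F tp n; have [_ _ vwt] := hv.
have comm w : rho hgt (rho y w) = rho y (rho hgt w) - e%:R *: rho y w.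
  have := rho_bracket w hl hyl; rewrite hyw // root_wtN he scaleNr.
  have -> : - (e%:R *: y) = (- e%:R) *: y + 0 by rewrite addr0 scaleNr.
  rewrite rho_linear //; last exact: lie0.
  by rewrite rho0 addr0 scale_lfunE scaleNr => ->; rewrite addrC subrK.
case: hu => [[ds ds0 hds]|->]; last first.
  exists [:: e]; rewrite /= ?e0 // comm vwt // linearZ /= -scalerBl -/vac_wt.
  by rewrite -scalerBl subrr scale0r.
exists (map (addn e) ds).
  by rewrite all_map; apply: sub_all ds0 => d /= d0; rewrite addn_gt0 d0 orbT.
suff -> : kill (map (addn e) ds) (rho y u) = rho y (kill ds u)
  by rewrite hds linear0.
elim: ds {ds0 hds} => //= d ds ->;
  rewrite comm (linearB (rho y)) (linearZ_LR (rho y)) /= natrD.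
rewrite -[LHS]addrA -opprD -scalerDl; congr (_ - _ *: _); ring.
Qed.

Lemma vac_not_below c : below (c *: v) -> c = 0.
Proof.
have [vn0 _ vwt] := hv; have [_ hd] := height_element_cartan F tp n.
case=> ds ds0; have -> : kill ds (c *: v) = (c * \prod_(d <- ds) d%:R) *: v.
  elim: ds {ds0} => [|d ds IH] /=; first by rewrite big_nil mulr1.
  rewrite IH linearZ /= vwt; last exact: height_element_cartan.
  rewrite big_cons !scalerA -scalerBl; congr (_ *: _); rewrite /vac_wt; ring.
move/eqP; rewrite scaler_eq0 mulf_eq0 => /orP[/orP[/eqP//|]|/eqP//].
rewrite prodf_seq_eq0 => /hasP[d /(allP ds0) d0 /=].
by rewrite pnatr_eq0 => /eqP e; rewrite e in d0.
Qed.

Lemma inner_conj (u u' : tensor) : inner u u' = (inner u' u)^*.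
Proof.
rewrite /inner rmorph_sum; apply: eq_bigr => G _.
by rewrite rmorphM /= conjCK mulrC.
Qed.

(** Both highest weight components carry the same coefficient. Lowering leaves no component along
    [alt], because the adjoint of a lowering operator is strictly upper triangular and kills
    [alt]. *)
Lemma linked_vac_part a b : linked a b -> exists c a' b',
  [/\ a = c *: v + a', b = c *: alt + b', below a' & inner b' alt = 0].
Proof.
have inner0 : inner (0 : tensor) alt = 0.
  by apply: big1 => G _; rewrite ffunE mul0r.
have below0 : below 0 by exists [::].
elim=> {a b} [|c a b a' b' _ [d [x [y [-> -> hx hy]]]] _ [d' [x' [y' [-> ->
  hx' hy']]]]|].
- by exists 1, 0, 0; rewrite !scale1r !addr0.
- exists (c * d + d'), (c *: x + x'), (c *: y + y'); split.
  + by rewrite scalerDl scalerDr scalerA addrACA.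
  + by rewrite scalerDl scalerDr scalerA addrACA.
  + exact: below_linear.
  + by rewrite inner_linear hy hy' mulr0 addr0.
move=> r y a b hy _ [c [x [z [-> -> hx hz]]]].
exists 0, (rho y (c *: v + x)), (tact y (c *: alt + z)).
rewrite !scale0r !add0r; split=> //.
  rewrite linearP; apply: below_linear; first by apply: below_low hy _; right.
  by apply: below_low hy _; left.
rewrite inner_tact (alternating_upper first_row_down) => [|i j].
  apply: big1 => G _; have -> : (0 : tensor) G = 0 :> F by rewrite ffunE.
  by rewrite conjC0 mulr0.
rewrite mxE conjC_eq0 => /(root_space_lower hy).
by case/andP.
Qed.

(** Contravariance moves the lowering operators from [b] over to [z], whose partner stays 0. What
    remains is the product of [alt] with such a [z], and it vanishes because 0 has no component
    along [v]. *)
Lemma linked0_orthogonal a b : linked a b ->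
  forall z, linked 0 z -> inner b z = 0.
Proof.
elim=> {a b} [z|c a b a' b' _ IH _ IH' z hz|r y a b hy _ IH z hz].
- case/linked_vac_part => c [x [y [e -> hx hy]]].
  have c0 : c = 0.
    apply/eqP; rewrite -oppr_eq0; apply/eqP/vac_not_below.
    by rewrite scaleNr; move/eqP: e; rewrite eq_sym addrC addr_eq0 => /eqP <-.
  by rewrite c0 scale0r add0r inner_conj hy conjC0.
- by rewrite inner_linear IH // IH' // mulr0 addr0.
have [hyl _] := hy; rewrite inner_tact; apply: IH.
have := linked_act (lie_adjoint hyl) hz.
by rewrite linear0.
Qed.

Lemma linked_fun a b b' : linked a b -> linked a b' -> b = b'.
Proof.
move=> h h'; apply/eqP; rewrite -subr_eq0; apply/eqP/inner_eq0.
have h0 : linked 0 (b - b').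
  by have := linked_lin (-1) h' h; rewrite !scaleN1r addNr addrC.
exact: (linked0_orthogonal h0 h0).
Qed.

Lemma linked_word (f : root -> 'M[F]_N) w :
    (forall a, root_space (- val a) (f a)) ->
  linked (foldr (fun a u => rho (f a) u) v w) (word_act (@bcol n m) first_row
    f w).
Proof.
move=> hf; elim: w => [|a w IH] /=; first exact: linked_vac.
exact: linked_low (hf a) IH.
Qed.

End Transfer.

(** * The correspondence *)

Section TableauCoefficients.
Variables (F : numClosedFieldType) (tp : cartan_type) (n : nat) (m : 'I_n ->
  nat).
Notation N := (natdim tp n).
Notation root := (posroot tp n).
Notation row := (@root_row tp n).
Notation ent := (@root_entry tp n).
Notation first_row := (row_tableau tp m).

Lemma entry_ne (T : filling tp m) b : T b <> first_row b -> entry T b <> brow b.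
Proof.
move=> h e; apply: h; apply: val_inj; apply: succn_inj.
by rewrite -[(val (T b)).+1]/(entry T b) e -(entry_row_tableau tp).
Qed.

Lemma sst_ordered (T : filling tp m) : PBW_semistandard T ->
  column_ordered (@bcol n m) first_row T.
Proof.
move=> [h1 h2 _ _]; split=> [b hb b' ec|b b' ec lt hb].
  rewrite -ltnS -[((T b).+1)%N]/(entry T b) -[((first_row b').+1)%N]/(entry _
    b').
  rewrite entry_row_tableau; apply: leq_ltn_trans (brow_col b') _.
  by rewrite ec ltnNge; apply/negP => /h1/entry_ne; apply.
rewrite -ltnS; apply: h2 => //; last exact: entry_ne.
by rewrite -!(entry_row_tableau tp) /entry ltnS.
Qed.

(** A matrix unit may also correspond to the flipped pair in type C; canonicity of the pairs in a
    semistandard tableau rules this out. *)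
Lemma lowers_sst (T : filling tp m) (a : root) b : PBW_semistandard T ->
  lowers a (first_row b) (T b) = (brow b == row a) && (entry T b == ent a).
Proof.
move=> hT; rewrite /lowers -ltnS -!/(entry _ b) entry_row_tableau.
apply/idP/idP => [/andP[lt /eqP e]|/andP[/eqP -> /eqP ->]].
  have ne : entry T b <> brow b by move=> e'; rewrite e' ltnn in lt.
  by have [-> ->] := root_pairE (sst_canonical hT ne) e; rewrite !eqxx.
by rewrite row_lt_ent -rootE eqxx.
Qed.

Lemma sst_covered (T : filling tp m) : PBW_semistandard T ->
  covered first_row (@lowers tp n) T.
Proof.
move=> hT b /entry_ne/(sst_root hT)[a [a1 a2]].
by exists a; rewrite lowers_sst // a1 a2 !eqxx.
Qed.

Lemma steps_multiplicity (T : filling tp m) (a : root) : PBW_semistandard T ->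
  steps (@lowers tp n) T first_row a = multiplicity T a.
Proof.
move=> hT; rewrite /multiplicity -sum1_card [RHS]big_mkcond;
  apply: eq_bigr => b _.
rewrite finset.inE -lowers_sst //; case: (boolP (lowers _ _ _));
  rewrite ?andbF //.
by case/andP=> ->.
Qed.

Lemma lowers_len (a : root) (i j : 'I_N) : lowers a j i ->
  (j < i)%N /\ (i - j = ent a - row a)%N.
Proof.
case/andP=> ji /eqP e; split=> //; have := root_height a.
by rewrite e (@eps_root_height tp) // => -[<-]; rewrite subSS.
Qed.

Lemma entry_wtE (T : filling tp m) b (h : 'M[F]_N) : cartan h ->
  entry_wt (tp := tp) (entry T b) h = eps (entry T b) h.
Proof.
move=> hh; rewrite /entry_wt; case: ifP => // /andP[C _].
by rewrite eps_bar ?opprK // entry_le.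
Qed.

(** Replacing the row number by the entry subtracts from the weight exactly the root that the box
    encodes. *)
Lemma tableau_wtE (T : filling tp m) (h : 'M[F]_N) : PBW_semistandard T ->
  cartan h -> tableau_wt T h = monomial_wt m [ffun a => multiplicity T a] h.
Proof.
move=> hT hh; rewrite /tableau_wt /monomial_wt hwtE; apply/eqP.
rewrite eq_sym subr_eq addrC -subr_eq -sumrB; apply/eqP.
transitivity (\sum_(b : box m) \sum_(a : root)
  (if (brow b == row a) && (entry T b == ent a) then root_wt (val a) h else 0
    : F)).
  apply: eq_bigr => b _; rewrite entry_wtE // -eps_diag -[_.+1]/(entry _ b)
    entry_row_tableau.
  have [->|/eqP ne] := eqVneq (entry T b) (brow b).
    rewrite subrr big1 // => a _; case: ifP => // /andP[/eqP -> /eqP e].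
    by have := row_lt_ent a; rewrite e ltnn.
  have [a [a1 a2]] := sst_root hT ne.
  have /and4P[r0 _ lt le] := canonical_pair_le (root_canonical a).
  rewrite (bigD1 a) //= a1 a2 !eqxx /= big1 ?addr0 => [|a' na].
    by rewrite rootE root_wt_eps ?r0 ?a1 ?a2 // -?a1 -?a2 // ltnW.
  case: ifP => // /andP[/eqP e1 /eqP e2]; case/eqP: na.
  by apply: root_pair_inj; rewrite ?a1 ?a2.
rewrite exchange_big; apply: eq_bigr => a _;
  rewrite /= ffunE /multiplicity -sumr_const.
by rewrite [RHS]big_mkcond; apply: eq_bigr => b _; rewrite finset.inE.
Qed.

End TableauCoefficients.

Lemma count_exponent_word (T : finType) (ord : seq T) (s : T -> nat) a :
  perm_eq ord (enum T) -> count_mem a (flatten [seq nseq (s b) b | b <- ord])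
    = s a.
Proof.
move=> /seq.permP hord; rewrite count_flatten -map_comp.
have -> : s a = (s a * count_mem a ord)%N.
  by rewrite hord count_uniq_mem ?enum_uniq // mem_enum muln1.
elim: ord {hord} => [|b ord IH] /=; first by rewrite muln0.
rewrite IH count_nseq mulnDr; congr addn; rewrite /=.
by case: eqP => [->|_]; rewrite ?mul1n ?muln1 ?mul0n ?muln0.
Qed.

Lemma monomial_vector_word (F : fieldType) (tp : cartan_type) (n : nat)
    (V : vectType F) (rho : 'M[F]_(natdim tp n) -> 'End(V))
    (f : posroot tp n -> 'M[F]_(natdim tp n)) ord v s :
  monomial_vector rho f ord v s =
  foldr (fun a u => rho (f a) u) v (flatten [seq nseq (s a) a | a <- ord]).
Proof.
rewrite /monomial_vector; elim: ord => //= a ord ->; rewrite foldr_cat.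
by elim: (s a) => //= k ->.
Qed.

Theorem proposition5p17 (R : realType) (tp : cartan_type) (n : nat)
    (hn : (0 < n)%N)
    (A : {pred 'rV[int]_n}) (hA : FFLV_admissible R[i] tp A)
    (m : 'I_n -> nat)
    (V : vectType R[i]) (rho : 'M[R[i]]_(natdim tp n) -> 'End(V))
    (hV : simple_module rho)
    (v : V) (hv : highest_weight_vector m rho v)
    (f : posroot tp n -> 'M[R[i]]_(natdim tp n))
    (hf : forall a : posroot tp n, root_space (- val a) (f a) /\ f a <> 0)
    (ord : seq (posroot tp n))
    (hord : perm_eq ord (enum (posroot tp n))) :
  exists phi : V -> filling tp m,
    set_bij [set monomial_vector rho f ord v s | s in S_A R A m]
            [set T : filling tp m | PBW_semistandard T /\ permissible A T]
            phi /\
    forall s, S_A R A m s ->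
      forall h : 'M[R[i]]_(natdim tp n), cartan h ->
        tableau_wt (phi (monomial_vector rho f ord v s)) h =
        monomial_wt m s h.
Proof.
have [rhoP _ _] := hV.
pose word (s : {ffun posroot tp n -> nat}) := flatten [seq nseq (s a) a | a <- ord].
have f_lowers a i j : (f a i j != 0) = lowers a j i.
  by have [h1 h2] := hf a; apply: root_vector_entry.
have inj_row := @first_row_inj tp n m.
have SA_tableau s : S_A R A m s ->
    exists2 T : filling tp m, PBW_semistandard T & multiplicity T =1 s.
  by case=> /polytope_chain /tableau_exists.
have mon_inj s t : S_A R A m s -> S_A R A m t ->
    monomial_vector rho f ord v s = monomial_vector rho f ord v t -> s = t.
  move=> /SA_tableau[T hT mT] /SA_tableau[T' hT' mT'] e.
  have lw w := @linked_word _ _ _ _ rho m v f w (fun a => proj1 (hf a)).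
  have {}e : word_act (@bcol n m) (row_tableau tp m) f (word s) =
             word_act (@bcol n m) (row_tableau tp m) f (word t).
    apply: (linked_fun rhoP hv (lw _)).
    by rewrite -monomial_vector_word e monomial_vector_word.
  (* The word of [s'] has a nonzero coefficient at its own tableau [U], hence so has the word of
     [t'], whose energy is thereby bounded. Used in both directions, this makes the energies
     equal. *)
  have aux (s' t' : {ffun posroot tp n ->
    nat}) (U : filling tp m) : PBW_semistandard U -> multiplicity U =1 s' ->
      word_act (@bcol n m) (row_tableau tp m) f (word s') =
      word_act (@bcol n m) (row_tableau tp m) f (word t') ->
    let E := energy (fun a => root_entry a - root_row a)%N in
    (E (word t') <= E (word s'))%N /\ (E (word t') = E (word s') -> s' = t').
    move=> hU mU e'.
    have cnt a : count_mem a (word s') = steps (@lowers tp n) U (row_tableau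
      tp m) a.
      by rewrite steps_multiplicity // mU count_exponent_word.
    have ordU := sst_ordered hU; have covU := sst_covered hU.
    have eE := energy_steps (@lowers_len tp n) (@lowers_uniq tp n) ordU covU
      cnt.
    have [k k0 ek] := word_act_leading inj_row f_lowers (@lowers_len tp n)
      (@lowers_uniq tp n) ordU covU cnt.
    have nz : word_act (@bcol n m) (row_tableau tp m) f (word t') U != 0.
      rewrite -e' ek mulf_neq0 ?pnatr_eq0 -?lt0n //.
      exact: leading_coef_neq0 f_lowers (@lowers_uniq tp n) _ ordU covU.
    have [le1 eq1] := energy_bound inj_row f_lowers (@lowers_len tp n)
      (@lowers_uniq tp n) ordU nz.
    rewrite /= eE; split=> // /eq1 ct; apply/ffunP => a.
    by rewrite -mU -steps_multiplicity // -ct count_exponent_word.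
  have [le1 eq1] := aux _ _ _ hT mT e;
    have [le2 _] := aux _ _ _ hT' mT' (esym e).
  by apply: eq1; apply/eqP; rewrite eqn_leq le1.
(* [phi] must be defined on all of [V]; its value away from the monomial vectors is arbitrary. *)
have /choice[phi hphi] : forall u : V, exists T : filling tp m,
    forall s, S_A R A m s -> monomial_vector rho f ord v s = u ->
      PBW_semistandard T /\ multiplicity T =1 s.
  move=> u; have [[s hs su]|no] := pselect (exists2 s, S_A R A m s &
      monomial_vector rho f ord v s = u); last first.
    by exists (row_tableau tp m) => s hs su; case: no; exists s.
  have [T hT mT] := SA_tableau _ hs; exists T => s' hs' s'u.
  by rewrite (mon_inj s' s hs' hs _) // su.
have {}hphi s (hs : S_A R A m s) := hphi _ s hs (erefl _).
exists phi; split; last first.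
  move=> s hs h hh; have [hT mT] := hphi _ hs; rewrite tableau_wtE //.
  by congr monomial_wt; apply/ffunP => a; rewrite ffunE mT.
split=> [_ [s hs <-]|_ _ /set_mem[s hs <-] /set_mem[t ht <-] e|T [hT pT]] /=.
- have [hT mT] := hphi _ hs; split=> //; apply/permissibleP => // a.
  by rewrite mT; case: hs => _; apply.
- have [_ ms] := hphi _ hs; have [_ mt] := hphi _ ht.
  suff -> : s = t by [].
  by apply/ffunP => a; rewrite -ms e mt.
pose s := [ffun a => multiplicity T a].
have hs : S_A R A m s.
  have p0 := proj1 (permissibleP A hT) pT.
  split; last by move=> a na; rewrite ffunE p0.
  apply/polytope_chain => p i z sp allp; under eq_bigr do rewrite ffunE.
  exact: multiplicity_chain_bounded.
exists (monomial_vector rho f ord v s); first by exists s.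
have [hT' mT'] := hphi _ hs.
by apply: multiplicity_inj => // a; rewrite mT' ffunE.
Qed.
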